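(* Let $(T_1,T_2)$ be a commuting contractive pair on $\mathcal H$, let $\Pi:\mathcal H\to\mathcal K$ be an isometry and let $(\mathbb W_1,\mathbb W_2,\mathbb W)$ be a triple of operators on $\mathcal K$. Then $(\Pi,\mathbb W_1,\mathbb W_2,\mathbb W)$ is the compression of an And\^o lift of $(T_1,T_2)$ to an embedded minimal isometric lift of $T=T_1T_2$ if and only if $(\Pi,\mathbb W_1,\mathbb W_2,\mathbb W)$ is a pseudo-commuting contractive lift of $(T_1,T_2)$.
   Context: Commuting contractive pair: commuting operators of norm at most $1$. And\^o lift of $(T_1,T_2)$: $(\boldsymbol\Pi,\mathbf V_1,\mathbf V_2)$ with $\boldsymbol\Pi:\mathcal H\to\boldsymbol{\mathcal K}$ isometric and $(\mathbf V_1,\mathbf V_2)$ commuting isometries on $\boldsymbol{\mathcal K}$ with $\mathbf V_j^*\boldsymbol\Pi=\boldsymbol\Pi T_j^*$. A minimal isometric lift of a contraction $T$ is $(\Pi,V)$ with $\Pi:\mathcal H\to\mathcal K$ isometric, $V$ an isometry on $\mathcal K$, $V^*\Pi=\Pi T^*$ and $\mathcal K=\bigvee_{n\ge0}V^n\operatorname{Ran}\Pi$. Compression: Let $(\boldsymbol\Pi,\mathbf V_1,\mathbf V_2)$ be an And\^o lift of $(T_1,T_2)$ on $\boldsymbol{\mathcal K}$ and put $\boldsymbol{\mathcal K}_{00}=\bigvee_{n\ge0}\mathbf V_1^n\mathbf V_2^n\operatorname{Ran}\boldsymbol\Pi$, which is invariant for $\mathbf V_1\mathbf V_2$; then $(\boldsymbol\Pi,\mathbf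 V_1\mathbf V_2|_{\boldsymbol{\mathcal K}_{00}})$, with $\boldsymbol\Pi$ viewed as a map into $\boldsymbol{\mathcal K}_{00}$, is a minimal isometric lift of $T=T_1T_2$. Let $(\Pi,V)$ on $\mathcal K$ be a minimal isometric lift of $T$ and $\tau:\mathcal K\to\boldsymbol{\mathcal K}_{00}\subset\boldsymbol{\mathcal K}$ the unitary (onto $\boldsymbol{\mathcal K}_{00}$) with $\tau\Pi=\boldsymbol\Pi$ and $\tau V=\mathbf V_1\mathbf V_2\tau$; view $\tau$ as an isometry into $\boldsymbol{\mathcal K}$. With $\mathbb W_1=\tau^*\mathbf V_1\tau$, $\mathbb W_2=\tau^*\mathbf V_2\tau$, $\mathbb W=\tau^*\mathbf V_1\mathbf V_2\tau=V$, one says that $(\Pi,\mathbb W_1,\mathbb W_2,\mathbb W)$ is the compression of the And\^o lift $(\boldsymbol\Pi,\mathbf V_1,\mathbf V_2)$ to the embedded minimal isometric lift $(\Pi,V)$ of $T$. Pseudo-commuting contractive lift: $(\Pi,\mathbb W_1,\mathbb W_2,\mathbb W)$, with $\Pi:\mathcal H\to\mathcal K$ isometric, is a pseudo-commuting contractive lift of $(T_1,T_2)$ if (i) $\mathbb W_1,\mathbb W_2$ are contractions and $\mathbb W$ is an isometry on $\mathcal K$; (ii) $\mathbb W_1$ and $\mathbb W_2$ each commute with $\mathbb W$; (iii) $\mathbb W_1=\mathbb W_2^*\mathbb W$; (iv) $(\mathbb W_1^*,\mathbb W_2^*,\mathbb W^* )\Pi=\Pi(T_1^*,T_2^*,T_1^*T_2^*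 )$; (v) $\mathcal K=\bigvee_{n\ge0}\mathbb W^n\operatorname{Ran}\Pi$. *)

(* Defs.v *)
From HB Require Import structures.
From mathcomp Require Import all_boot all_order all_algebra.
From mathcomp Require Import sesquilinear complex.
From mathcomp Require Import boolp classical_sets functions reals.
From mathcomp Require Import topology normedtype.

Set Implicit Arguments.
Unset Strict Implicit.
Unset Printing Implicit Defensive.

Import Order.TTheory GRing.Theory Num.Theory.
Import numFieldNormedType.Exports.

Local Open Scope classical_set_scope.
Local Open Scope complex_scope.
Local Open Scope ring_scope.

(* Complex Hilbert spaces.  The inner product is linear in its first argument
   and conjugate-linear in its second.  Norms take values in R[i]; they are
   real there, so [<=] between norms is the usual order. *)
HB.mixin Record CompleteNormedModule_isHilbert (R : realType) H
    & CompleteNormedModule R[i] H := {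
  inner : {dot H for (@Num.conj R[i])} ;
  inner_norm : forall x : H, inner x x = `|x| ^+ 2
}.

#[short(type="hilbertType")]
HB.structure Definition Hilbert (R : realType) :=
  {H of CompleteNormedModule R[i] H & CompleteNormedModule_isHilbert R H}.

Section Operators.
Variables (R : realType) (H K : hilbertType R).

Definition isometric (A : H -> K) := forall x, `|A x| = `|x|.

Definition contractive (A : H -> K) := forall x, `|A x| <= `|x|.

(* [adjoint A y] is the vector z with <A x, y> = <x, z> for all x.  Such a z
   is always unique, and it exists (Riesz) when A is linear and continuous;
   for other maps A the value is not meaningful. *)
Definition adjoint (A : H -> K) (y : K) : H :=
  xget 0 [set z | forall x, inner (A x) y = inner x z].

Definition linear_span (S : set H) : set H :=
  [set x | exists (n : nat) (c : 'I_n -> R[i]) (v : 'I_n -> H),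
     (forall i, S (v i)) /\ x = \sum_(i < n) c i *: v i].

Definition closed_span (S : set H) : set H := closure (linear_span S).

End Operators.

Section Lifts.
Variables (R : realType) (H K : hilbertType R).

Record commuting_contractive_pair (T1 T2 : {linear H -> H}) : Prop := {
  pair_commute : T1 \o T2 =1 T2 \o T1 ;
  pair_contractive1 : contractive T1 ;
  pair_contractive2 : contractive T2 }.

Record minimal_isometric_lift (T : {linear H -> H})
    (Pi : {linear H -> K}) (V : {linear K -> K}) : Prop := {
  mil_embedding : isometric Pi ;
  mil_isometric : isometric V ;
  mil_lift : adjoint V \o Pi =1 Pi \o adjoint T ;
  mil_minimal : closed_span (\bigcup_n (iter n V @` range Pi)) = [set: K] }.

Record ando_lift (T1 T2 : {linear H -> H})
    (Pi : {linear H -> K}) (V1 V2 : {linear K -> K}) : Prop := {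
  ando_embedding : isometric Pi ;
  ando_isometric1 : isometric V1 ;
  ando_isometric2 : isometric V2 ;
  ando_commute : V1 \o V2 =1 V2 \o V1 ;
  ando_lift1 : adjoint V1 \o Pi =1 Pi \o adjoint T1 ;
  ando_lift2 : adjoint V2 \o Pi =1 Pi \o adjoint T2 }.

(* The subspace K_00 spanned by the V1^n V2^n (Ran Pi), n >= 0. *)
Definition ando_core (Pi : {linear H -> K}) (V1 V2 : {linear K -> K}) : set K :=
  closed_span (\bigcup_n ((iter n V1 \o iter n V2) @` range Pi)).

Record pseudo_commuting_contractive_lift (T1 T2 : {linear H -> H})
    (Pi : {linear H -> K}) (W1 W2 W : {linear K -> K}) : Prop := {
  pcc_embedding : isometric Pi ;
  pcc_contractive1 : contractive W1 ;
  pcc_contractive2 : contractive W2 ;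
  pcc_isometric : isometric W ;
  pcc_commute1 : W1 \o W =1 W \o W1 ;
  pcc_commute2 : W2 \o W =1 W \o W2 ;
  pcc_factor : W1 =1 adjoint W2 \o W ;
  pcc_lift1 : adjoint W1 \o Pi =1 Pi \o adjoint T1 ;
  pcc_lift2 : adjoint W2 \o Pi =1 Pi \o adjoint T2 ;
  pcc_lift : adjoint W \o Pi =1 Pi \o (adjoint T1 \o adjoint T2) ;
  pcc_minimal : closed_span (\bigcup_n (iter n W @` range Pi)) = [set: K] }.

End Lifts.

Section Compression.
Variables (R : realType) (H K L : hilbertType R).

(* The lift (PPi, VV1, VV2) on L is compressed to (Pi, V) on K.  The map tau is
   unitary from K onto K_00, viewed as an isometry into L. *)
Record compression_along (Pi : {linear H -> K}) (V : {linear K -> K})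
    (PPi : {linear H -> L}) (VV1 VV2 : {linear L -> L}) (tau : {linear K -> L})
    (W1 W2 W : {linear K -> K}) : Prop := {
  comp_isometric : isometric tau ;
  comp_onto : range tau = ando_core PPi VV1 VV2 ;
  comp_embedding : tau \o Pi =1 PPi ;
  comp_intertwine : tau \o V =1 (VV1 \o VV2) \o tau ;
  comp_W1 : W1 =1 adjoint tau \o VV1 \o tau ;
  comp_W2 : W2 =1 adjoint tau \o VV2 \o tau ;
  comp_W : W =1 adjoint tau \o (VV1 \o VV2) \o tau }.

End Compression.

Definition is_ando_compression (R : realType) (H K : hilbertType R)
    (T1 T2 : {linear H -> H}) (Pi : {linear H -> K})
    (W1 W2 W : {linear K -> K}) : Prop :=
  exists V : {linear K -> K},
    minimal_isometric_lift (T1 \o T2) Pi V /\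
  exists (L : hilbertType R) (PPi : {linear H -> L}) (VV1 VV2 : {linear L -> L})
      (tau : {linear K -> L}),
    ando_lift T1 T2 PPi VV1 VV2 /\
    compression_along Pi V PPi VV1 VV2 tau W1 W2 W.

(* Main.v *)
(** The entries [<W1 W^m Pi h, W^n Pi k>] of a pseudo-commuting contractive lift are
    determined by [T1], [T2] and [(Pi, W)], so [W1] and [W2] are unique. Since the
    compression of any And\^o lift is pseudo-commuting ([K_00] reduces [V1 V2]), the
    converse follows from And\^o's theorem together with the embedding of the minimal
    lift [(Pi, W)] into an And\^o lift.

    For And\^o's theorem, lift [T1], [T2] to [H + l^2(F)], acting on the second summand
    by [U (P' + S P)] and [(P + S P') U^*], where [P] is a projection, [P' = 1 - P],
    [S] is the shift and the unitary [U] exchanges the defect vectors of [T1 T2] and [T2 T1]. Such a [U]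
    needs no dimension count once [F] is doubled: a reflection in the graph of the
    partial isometry to be extended, followed by a flip, will do. *)
Require Import Defs.
From HB Require Import structures.
From mathcomp Require Import all_boot all_order all_algebra.
From mathcomp Require Import sesquilinear complex.
From mathcomp Require Import boolp classical_sets functions reals.
From mathcomp Require Import topology normedtype sequences.
From mathcomp Require Import ring lra.

Set Implicit Arguments.
Unset Strict Implicit.
Unset Printing Implicit Defensive.

Import Order.TTheory GRing.Theory Num.Theory.
Import numFieldNormedType.Exports.

Local Open Scope classical_set_scope.
Local Open Scope complex_scope.
Local Open Scope ring_scope.

(** * Real part of the Hilbert structure *)

(** In the converse direction the And\^o lift is chosen without reference to [W1] and [W2];
    uniqueness then forces its compression to be the given one. In an entry
    [<W1 W^m Pi h, W^n Pi k>] common powers of [W] cancel, so [m = 0] or [n = 0] remains. The case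
    [n = 0] is settled by [adjoint W1] on [Ran Pi]. The case [m = 0 < n] needs the factorization, in
    the form [<W1 x, W y> = <x, W2 y>], which trades [W1] for [W2].

    The vectors to be exchanged are [a h = (D1 T2 h, D2 h)] and [b h = (D1 h, D2 T1 h)], with [D1],
    [D2] the defect operators. Both have squared norm [|h|^2 - |T1 T2 h|^2], but in infinite
    dimension the isometry [a h -> b h] may fail to extend to a unitary, its domain and range having
    different codimensions. This is why the ambient space is doubled: there [(a h, b h)] and
    [(a k, - b k)] are orthogonal, so the reflection in the graph sends [(a h, 0)] to [(0, b h)].

    The same orthogonality yields [tau]: projecting [(x, 0)] on the closed graph gives half of the
    graph point over [x].

    Estimates are made on real parts, where ordered-field reasoning applies; complex linearity
    restores the rest. *)

Definition rnorm (R : realType) (H : hilbertType R) (x : H) : R := complex.Re `|x|.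

Definition rinner (R : realType) (H : hilbertType R) (x y : H) : R :=
  complex.Re (inner x y).

Section RealStructure.
Variables (R : realType) (H : hilbertType R).
Implicit Types (x y z : H) (a b : R[i]) (t : R).

Lemma rnormE x : `|x| = (rnorm x)%:C.
Proof. by rewrite /rnorm RRe_real // normr_real. Qed.

Lemma innerDl x y z : inner (x + y) z = inner x z + inner y z.
Proof. exact: linearDl. Qed.

Lemma innerDr x y z : inner z (x + y) = inner z x + inner z y.
Proof. exact: linearDr. Qed.

Lemma innerZl a x y : inner (a *: x) y = a * inner x y.
Proof. exact: linearZl_LR. Qed.

Lemma innerC x y : inner x y = (inner y x)^*.
Proof. by rewrite [LHS](@hermitian_subproof _ _ false) expr0 mul1r. Qed.

Lemma innerZr a x y : inner x (a *: y) = a^* * inner x y.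
Proof. by rewrite innerC innerZl rmorphM /= -innerC. Qed.

Lemma rinnerDl x y z : rinner (x + y) z = rinner x z + rinner y z.
Proof. by rewrite /rinner innerDl raddfD. Qed.

Lemma rinnerC x y : rinner x y = rinner y x.
Proof. by rewrite /rinner innerC; case: (inner y x). Qed.

Lemma rinnerDr x y z : rinner z (x + y) = rinner z x + rinner z y.
Proof. by rewrite rinnerC rinnerDl !(rinnerC z). Qed.

Lemma rinnerZl t x y : rinner (t%:C *: x) y = t * rinner x y.
Proof. by rewrite /rinner innerZl; case: (inner x y) => p q /=; rewrite mul0r subr0. Qed.

Lemma rinnerZr t x y : rinner x (t%:C *: y) = t * rinner x y.
Proof. by rewrite rinnerC rinnerZl rinnerC. Qed.

Lemma rinnerNl x y : rinner (- x) y = - rinner x y.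
Proof.
have -> : - x = (-1 : R)%:C *: x by rewrite rmorphN rmorph1 scaleN1r.
by rewrite rinnerZl mulN1r.
Qed.

Lemma rinnerNr x y : rinner x (- y) = - rinner x y.
Proof. by rewrite rinnerC rinnerNl rinnerC. Qed.

Lemma rinner0l y : rinner 0 y = 0.
Proof. by rewrite -(scale0r (0 : H)) -[0 in LHS](rmorph0 (real_complex R)) rinnerZl mul0r. Qed.

Lemma rinner0r y : rinner y 0 = 0.
Proof. by rewrite rinnerC rinner0l. Qed.

Lemma rinnerE x : rinner x x = rnorm x ^+ 2.
Proof. by rewrite /rinner inner_norm rnormE -rmorphXn. Qed.

Definition rinnerS := (rinnerDl, rinnerDr, rinnerNl, rinnerNr, rinnerZl, rinnerZr).

Lemma rnorm_ge0 x : 0 <= rnorm x.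
Proof. by have := normr_ge0 x; rewrite rnormE lecR. Qed.

Lemma rnorm0_eq0 x : rnorm x = 0 -> x = 0.
Proof. by move=> h; apply/normr0_eq0; rewrite rnormE h. Qed.

Lemma rnormD x y : rnorm (x + y) <= rnorm x + rnorm y.
Proof. by have := ler_normD x y; rewrite !rnormE -rmorphD lecR. Qed.

Lemma rnormN x : rnorm (- x) = rnorm x.
Proof. by rewrite /rnorm normrN. Qed.

Lemma rnormB x y : rnorm (x - y) = rnorm (y - x).
Proof. by rewrite -rnormN opprB. Qed.

Lemma rnormZ t x : rnorm (t%:C *: x) = `|t| * rnorm x.
Proof.
apply: (@complexI R); rewrite -rnormE normrZ rnormE rmorphM /=; congr (_ * _).
by rewrite normc_def /= expr0n addr0 sqrtr_sqr.
Qed.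

Lemma rnorm0 : rnorm (0 : H) = 0.
Proof. by rewrite /rnorm normr0. Qed.

(** Cauchy-Schwarz, by expanding the square of [|y| x - |x| y]. Zero vectors are treated apart
    because the outcome is divided by [|x| |y|]. *)
Lemma rinner_le x y : rinner x y <= rnorm x * rnorm y.
Proof.
have [x0|x0] := eqVneq (rnorm x) 0.
  by rewrite (rnorm0_eq0 x0) rinner0l mulr_ge0 // rnorm_ge0.
have [y0|y0] := eqVneq (rnorm y) 0.
  by rewrite (rnorm0_eq0 y0) rinner0r mulr_ge0 // rnorm_ge0.
have p0 : 0 < rnorm x * rnorm y.
  by rewrite mulr_gt0 // lt_def ?x0 ?y0 rnorm_ge0.
have : 0 <= rinner ((rnorm y)%:C *: x - (rnorm x)%:C *: y)
                   ((rnorm y)%:C *: x - (rnorm x)%:C *: y).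
  by rewrite rinnerE sqr_ge0.
rewrite !rinnerS !rinnerE (rinnerC y x) => h.
rewrite -(ler_pM2l p0); nra.
Qed.

Lemma rinner_norm x y : `|rinner x y| <= rnorm x * rnorm y.
Proof.
by rewrite ler_norml rinner_le andbT lerNl -rinnerNl -(rnormN x) rinner_le.
Qed.

(** Conjugate-linearity in the second argument turns ['i *: y] into a factor [- 'i], whose real part
    is the imaginary part of [inner x y]. This is what allows the real inner product to carry the
    whole development. *)
Lemma innerE x y : inner x y = (rinner x y) +i* (rinner x ('i *: y)).
Proof.
rewrite /rinner innerZr; case: (inner x y) => p q /=.
by congr (_ +i* _); rewrite mul0r mulN1r opprK add0r.
Qed.

Lemma rinner_ext x y : (forall z, rinner z x = rinner z y) -> x = y.
Proof.
move=> h; apply/eqP; rewrite -subr_eq0; apply/eqP/rnorm0_eq0/eqP.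
by rewrite -sqrf_eq0 -rinnerE rinnerDr rinnerNr h subrr.
Qed.

Lemma rinnerZi x y : rinner ('i *: x) y = - rinner x ('i *: y).
Proof.
rewrite /rinner innerZl innerZr; case: (inner x y) => p q /=.
by rewrite !mul0r !sub0r mulN1r mul1r opprK.
Qed.

Lemma rnorm_le_sqr x y : (rnorm x <= rnorm y) = (rnorm x ^+ 2 <= rnorm y ^+ 2).
Proof. by rewrite ler_sqr // nnegrE rnorm_ge0. Qed.

End RealStructure.

(* Since [A] commutes with multiplication by ['i], testing real parts is enough. *)
Lemma inner_rinner (R : realType) (H K : hilbertType R) (A : {linear H -> K}) y z :
  (forall x, rinner (A x) y = rinner x z) -> forall x, inner (A x) y = inner x z.
Proof.
move=> h x; rewrite !innerE h; congr (_ +i* _).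
by apply/oppr_inj; rewrite -!rinnerZi -linearZ h.
Qed.

(** * Sequential convergence with real tolerances *)

Section Sequences.
Variables (R : realType) (H : hilbertType R).
Implicit Types (u : nat -> H) (l : H).

Definition tends u l :=
  forall e : R, 0 < e -> exists N, forall n, (N <= n)%N -> rnorm (u n - l) < e.

Definition fundamental u :=
  forall e : R, 0 < e -> exists N,
    forall m n, (N <= m)%N -> (N <= n)%N -> rnorm (u m - u n) < e.

Lemma fundamental_tends u : fundamental u -> exists l, tends u l.
Proof.
move=> hu.
have cu : cauchy (u @ \oo).
  apply: cauchy_exP => e e0.
  have re : e = (complex.Re e)%:C by rewrite RRe_real // ger0_real // ltW.
  have [N hN] := hu (complex.Re e) ltac:(by rewrite re ltcR in e0).
  exists (u N); exists N => // n /= Nn.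
  by rewrite -ball_normE /= rnormE re ltcR hN.
have [l hl] : exists l, u @ \oo --> l by apply/cvg_ex; exact: cauchy_cvg.
exists l => e e0.
have /cvgrPdist_lt/(_ e%:C) := hl; rewrite ltcR => /(_ e0) [N _ hN].
by exists N => n /hN /=; rewrite rnormE ltcR rnormB.
Qed.

Lemma tends_unique u l l' : tends u l -> tends u l' -> l = l'.
Proof.
move=> h h'; apply/eqP; rewrite -subr_eq0; apply/eqP/rnorm0_eq0/eqP.
rewrite eq_le rnorm_ge0 andbT; apply/ler_addgt0Pr => e e0; rewrite add0r.
have e2 : 0 < e / 2 by rewrite divr_gt0.
have [N hN] := h _ e2; have [N' hN'] := h' _ e2.
have := hN (maxn N N') (leq_maxl _ _); have := hN' (maxn N N') (leq_maxr _ _).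
set v := u _; rewrite rnormB => a b.
have -> : l - l' = (l - v) + (v - l') by rewrite subrKA.
have := rnormD (l - v) (v - l'); rewrite (rnormB l v) (rnormB v l'); lra.
Qed.

End Sequences.

(** * Riesz representation and adjoints *)

Record subspace_closed (R : realType) (H : hilbertType R) (M : set H) : Prop := {
  subspace_closed0 : M 0 ;
  subspace_closedD : forall x y, M x -> M y -> M (x + y) ;
  subspace_closedZ : forall (a : R[i]) x, M x -> M (a *: x) ;
  subspace_closed_lim : forall u l, (forall n, M (u n)) -> tends u l -> M l }.

Lemma invS_small (R : realType) (e : R) : 0 < e ->
  exists N, forall n, (N <= n)%N -> n.+1%:R^-1 < e.
Proof.
move=> e0; exists (Num.truncn e^-1) => n Nn.
rewrite -[ltRHS]invrK ltf_pV2 ?posrE ?invr_gt0 // ?ltr0n //.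
by rewrite (lt_le_trans (truncnS_gt _)) // ler_nat.
Qed.

(** The vanishing of the first variation at a minimum. The test value [- b / (a + 1)] replaces the
    exact minimizer [- b / a] so that [a = 0] is covered. *)
Lemma quadratic_ge0_eq0 (R : realType) (a b : R) : 0 <= a ->
  (forall t, 0 <= t ^+ 2 * a + 2 * t * b) -> b = 0.
Proof.
move=> a0 h; apply/eqP; rewrite -sqrf_eq0 eq_le sqr_ge0 andbT.
have a1 : 0 < a + 1 by lra.
have := h (- b / (a + 1)).
have -> : (- b / (a + 1)) ^+ 2 * a + 2 * (- b / (a + 1)) * b
   = - b ^+ 2 * ((a + 2) / (a + 1) ^+ 2) by field; rewrite gt_eqF.
rewrite pmulr_lge0 ?oppr_ge0 //.
by rewrite divr_gt0 // ?exprn_gt0 //; lra.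
Qed.

(* The representing vector minimizes [|x|^2 - 2 phi x] over [M]; by the
   parallelogram identity every minimizing sequence is fundamental. *)
Lemma riesz (R : realType) (H : hilbertType R) (M : set H) (phi : H -> R) (C : R) :
  subspace_closed M ->
  (forall x y, phi (x + y) = phi x + phi y) ->
  (forall (t : R) x, phi (t%:C *: x) = t * phi x) ->
  (forall x, phi x <= C * rnorm x) ->
  exists2 z, M z & forall x, M x -> phi x = rinner x z.
Proof.
move=> [M0 MD MZ Ml] phiD phiZ phiC.
pose J x := rnorm x ^+ 2 - 2 * phi x.
(* Completing the square: [|x|^2 - 2 C |x| >= - C^2]. *)
have Jge x : - C ^+ 2 <= J x.
  have := phiC x; have := sqr_ge0 (rnorm x - C); rewrite /J; nra.
have hJ : has_inf [set J x | x in M].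
  by split; [exists (J 0), 0 | exists (- C ^+ 2) => _ [x _ <-]].
pose d := inf [set J x | x in M].
have dJ x : M x -> d <= J x by move=> Mx; apply: ge_inf; [case: hJ | exists x].
have ex n : exists x, M x /\ J x < d + n.+1%:R^-1.
  have n0 : 0 < n.+1%:R^-1 :> R by rewrite invr_gt0 ltr0n.
  by have [_ [x Mx <-] hx] := inf_adherent n0 hJ; exists x.
have [u hu] := choice ex.
have Mu n : M (u n) by case: (hu n).
have Ju n : J (u n) < d + n.+1%:R^-1 by case: (hu n).
have JD x y (t : R) :
    J (x + t%:C *: y) = J x + t ^+ 2 * rnorm y ^+ 2 + 2 * t * (rinner y x - phi y).
  rewrite /J phiD phiZ -!rinnerE !rinnerS (rinnerC x y); ring.
have par x y : rnorm (x - y) ^+ 2 + 4 * J ((2^-1)%:C *: (x + y)) = 2 * J x + 2 * J y.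
  rewrite /J phiZ phiD -!rinnerE !rinnerS (rinnerC x y); by field.
have cu : fundamental u.
  move=> e e0; have e20 : 0 < e ^+ 2 / 4 by rewrite divr_gt0 // exprn_gt0.
  have [N hN] := invS_small e20; exists N => m n Nm Nn.
  have := par (u m) (u n).
  have := dJ _ (MZ (2^-1)%:C _ (MD _ _ (Mu m) (Mu n))).
  have := hN _ Nm; have := hN _ Nn; have := Ju m; have := Ju n.
  set p := _^-1; set q := _^-1 => h1 h2 h3 h4 h5 h6.
  by rewrite -(ltr_sqr (rnorm_ge0 _) (ltW e0)); lra.
have [z hz] := fundamental_tends cu.
exists z; first exact: Ml hz.
move=> x Mx; apply/esym/eqP; rewrite -subr_eq0; apply/eqP.
(* The first variation is computed at [u n] instead of [z]: from [J (u n + t x) >= d] and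
   [J (u n) < d + 1 / (n + 1)] the quadratic in [t] is nonnegative up to an error that tends to
   0. *)
apply: (@quadratic_ge0_eq0 _ (rnorm x ^+ 2)); first exact: sqr_ge0.
move=> t; apply/ler_addgt0Pr => e e0.
(* The distance from [u n] to [z] that keeps the cross term below [e / 2]; the [+ 1] keeps the
   denominator positive when [t] or [x] vanishes. *)
have t0 : 0 < e / 2 / (2 * `|t| * rnorm x + 1).
  rewrite divr_gt0 //; first by rewrite divr_gt0.
  by have := mulr_ge0 (normr_ge0 t) (rnorm_ge0 x); lra.
have e20 : 0 < e / 2 by rewrite divr_gt0.
have [N hN] := hz _ t0; have [N' hN'] := invS_small e20.
pose n := maxn N N'.
have {}hN := hN n (leq_maxl _ _); have {}hN' := hN' n (leq_maxr _ _).
have := dJ _ (MD _ _ (Mu n) (MZ t%:C _ Mx)); rewrite JD; have := Ju n.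
have -> : rinner x (u n) = rinner x z + rinner x (u n - z).
  by rewrite rinnerDr rinnerNr; ring.
suff : 2 * t * rinner x (u n - z) <= e / 2.
  move: hN' Mx => + _; set v := _^-1; set b := rinner x (u n - z).
  set c := rinner x z; set w := J _; move=> h1 h2 h3 h4; lra.
apply: le_trans (ler_norm _) _; rewrite !normrM (ger0_norm (ler0n _ 2)).
have := rinner_norm x (u n - z); move: hN; rewrite ltr_pdivlMr; last first.
  by have := mulr_ge0 (normr_ge0 t) (rnorm_ge0 x); lra.
have := rnorm_ge0 (u n - z); have := normr_ge0 t.
set p := rnorm x; set q := rnorm (u n - z); set r := `|t|; set s := `|rinner _ _|.
move=> r0 q0 h1 /(ler_wpM2l r0) h2; lra.
Qed.

Lemma rinner_orthoD (R : realType) (H : hilbertType R) (x y : H) : rinner x y = 0 ->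
  rinner (x + y) (x + y) = rinner x x + rinner y y.
Proof. by move=> h; rewrite !rinnerS (rinnerC y) h addr0 add0r. Qed.

Lemma isometric_rinner (R : realType) (H K : hilbertType R) (A : H -> K) :
  (forall x, rinner (A x) (A x) = rinner x x) -> isometric A.
Proof.
move=> h x; rewrite !rnormE; congr _%:C; apply/eqP.
by rewrite -(eqrXn2 (n := 2)) ?rnorm_ge0 // -!rinnerE h.
Qed.

Section NormReal.
Variables (R : realType) (H K : hilbertType R).

Lemma contractiveE (A : H -> K) : contractive A <-> forall x, rnorm (A x) <= rnorm x.
Proof. by split=> h x; have := h x; rewrite !rnormE lecR. Qed.

Lemma isometricE (A : H -> K) : isometric A <-> forall x, rnorm (A x) = rnorm x.
Proof. by split=> h x; have := h x; rewrite !rnormE; [move/complexI|move->]. Qed.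

End NormReal.

Section Adjoint.
Variables (R : realType) (H K : hilbertType R).

Lemma isometric_contractive (A : H -> K) : isometric A -> contractive A.
Proof. by move=> h x; rewrite h. Qed.

Lemma rinner_isometric (A : {linear H -> K}) : isometric A ->
  forall x y, rinner (A x) (A y) = rinner x y.
Proof.
move=> /isometricE h x y.
have := h (x + y); move/(congr1 (fun t => t ^+ 2)); rewrite -!rinnerE linearD /=.
rewrite !rinnerS !rinnerE !h (rinnerC y) (rinnerC (A y)); lra.
Qed.

Lemma rinner_adjoint (A : {linear H -> K}) : contractive A ->
  forall x y, rinner (A x) y = rinner x (adjoint A y).
Proof.
move=> /contractiveE hA x y.
have [|x1 x2|t x1|x1|z _ hz] := @riesz R H setT (fun x => rinner (A x) y) (rnorm y).
- by split.
- by rewrite linearD rinnerDl.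
- by rewrite linearZ rinnerZl.
- by rewrite (le_trans (rinner_le _ _)) // mulrC ler_wpM2l ?rnorm_ge0.
(* The default value of [xget] is excluded: the Riesz vector represents the real part, hence the
   full inner product by [inner_rinner]. *)
rewrite /adjoint; case: xgetP => [z' _ /= hz'|/(_ z) []].
  by rewrite /rinner hz'.
by apply: inner_rinner => x1; apply: hz.
Qed.

Lemma adjoint_eq (A : {linear H -> K}) y z : contractive A ->
  (forall x, rinner (A x) y = rinner x z) -> adjoint A y = z.
Proof. by move=> hA h; apply: rinner_ext => x; rewrite -h rinner_adjoint. Qed.

Lemma adjoint_linear (A : {linear H -> K}) : contractive A -> linear (adjoint A).
Proof.
move=> hA a x y; apply: rinner_ext => z; rewrite -rinner_adjoint // /rinner.
rewrite innerDr innerZr raddfD /= [in RHS]innerDr innerZr raddfD /=.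
have h v : inner (A z) v = inner z (adjoint A v).
  by apply: inner_rinner => z'; apply: rinner_adjoint.
by rewrite !h.
Qed.

Lemma adjoint_contractive (A : {linear H -> K}) : contractive A -> contractive (adjoint A).
Proof.
move=> hA; apply/contractiveE => y.
have [->|n0] := eqVneq (rnorm (adjoint A y)) 0; first exact: rnorm_ge0.
have p0 : 0 < rnorm (adjoint A y) by rewrite lt_def n0 rnorm_ge0.
rewrite -(ler_pM2l p0) -expr2 -rinnerE -rinner_adjoint //.
rewrite (le_trans (rinner_le _ _)) // ler_wpM2r ?rnorm_ge0 //.
by move/contractiveE: hA.
Qed.

End Adjoint.

Lemma linear_of (R : pzRingType) (U V : lmodType R) (f : U -> V) :
  linear f -> exists g : {linear U -> V}, g =1 f.
Proof.
move=> hf; pose mf := GRing.isLinear.Build R U V *:%R f hf.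
by exists (HB.pack_for {linear U -> V} f mf).
Qed.

(** * Building Hilbert spaces: direct sums and square-summable sequences *)

(* The complex inner product is recovered from its real part [re_ip] as
   [re_ip x y +i* re_ip x ('i *: y)]. *)
HB.factory Record Lmodule_isHilbert (R : realType) H & GRing.Lmodule R[i] H := {
  re_ip : H -> H -> R ;
  re_ipDl : forall x y z, re_ip (x + y) z = re_ip x z + re_ip y z ;
  re_ipZl : forall (t : R) x y, re_ip (t%:C *: x) y = t * re_ip x y ;
  re_ipC : forall x y, re_ip x y = re_ip y x ;
  re_ip_i : forall x y, re_ip ('i *: x) ('i *: y) = re_ip x y ;
  re_ip_ge0 : forall x, 0 <= re_ip x x ;
  re_ip_eq0 : forall x, re_ip x x = 0 -> x = 0 ;
  re_ip_complete : forall u : nat -> H,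
    (forall e : R, 0 < e -> exists N, forall m n, (N <= m)%N -> (N <= n)%N ->
      re_ip (u m - u n) (u m - u n) < e) ->
    exists l, forall e : R, 0 < e -> exists N, forall n, (N <= n)%N ->
      re_ip (u n - l) (u n - l) < e }.

HB.builders Context R H & Lmodule_isHilbert R H.

Let ipDr x y z : re_ip z (x + y) = re_ip z x + re_ip z y.
Proof. by rewrite re_ipC re_ipDl !(re_ipC z). Qed.

Let ipZr (t : R) x y : re_ip x (t%:C *: y) = t * re_ip x y.
Proof. by rewrite re_ipC re_ipZl re_ipC. Qed.

Let ii (x : H) : 'i *: ('i *: x) = (-1 : R)%:C *: x.
Proof. by rewrite scalerA; congr (_ *: _); rewrite -expr2 sqr_i rmorphN1. Qed.

Let ip_il x y : re_ip ('i *: x) y = - re_ip x ('i *: y).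
Proof. by rewrite -re_ip_i ii re_ipZl mulN1r. Qed.

Let ip_ix x : re_ip x ('i *: x) = 0.
Proof. have := ip_il x x; rewrite re_ipC; lra. Qed.

Let cE (a : R[i]) (x : H) :
  a *: x = (complex.Re a)%:C *: x + (complex.Im a)%:C *: ('i *: x).
Proof.
rewrite scalerA -scalerDl; congr (_ *: _).
by case: a => p q; apply/eqP; rewrite eq_complex /=; apply/andP; split; apply/eqP; ring.
Qed.

Let nrm x : R[i] := (Num.sqrt (re_ip x x))%:C.

Let cauchy_schwarz x y : re_ip x y <= Num.sqrt (re_ip x x) * Num.sqrt (re_ip y y).
Proof.
have [x0|x0] := eqVneq (re_ip x x) 0.
  by rewrite (re_ip_eq0 x0) -[X in re_ip X _](scale0r (0 : H)) (re_ipZl 0) mul0r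
     mulr_ge0 // sqrtr_ge0.
have [y0|y0] := eqVneq (re_ip y y) 0.
  by rewrite (re_ip_eq0 y0) re_ipC -[X in re_ip X _](scale0r (0 : H)) (re_ipZl 0) mul0r
     mulr_ge0 // sqrtr_ge0.
have := sqr_sqrtr (re_ip_ge0 x); have := sqr_sqrtr (re_ip_ge0 y).
have : 0 < Num.sqrt (re_ip x x) * Num.sqrt (re_ip y y).
  by rewrite mulr_gt0 // sqrtr_gt0 lt_def ?x0 ?y0 re_ip_ge0.
set p := Num.sqrt _; set q := Num.sqrt _ => pq0 q2 p2.
have := re_ip_ge0 (q%:C *: x + (- p)%:C *: y).
rewrite !(re_ipDl, ipDr, re_ipZl, ipZr) -p2 -q2 (re_ipC y x) => h.
rewrite -(ler_pM2l pq0); nra.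
Qed.

Let nrmD x y : nrm (x + y) <= nrm x + nrm y.
Proof.
rewrite /nrm -rmorphD lecR -[leRHS]ger0_norm ?addr_ge0 ?sqrtr_ge0 //.
rewrite -sqrtr_sqr ler_wsqrtr // re_ipDl !ipDr sqrrD !sqr_sqrtr ?re_ip_ge0 //.
by have := cauchy_schwarz x y; rewrite (re_ipC y x); lra.
Qed.

Let nrmZ (a : R[i]) x : nrm (a *: x) = `|a| * nrm x.
Proof.
rewrite /nrm normc_def -rmorphM -sqrtrM ?addr_ge0 ?sqr_ge0 //; congr (Num.sqrt _)%:C.
rewrite cE !(re_ipDl, ipDr, re_ipZl, ipZr) re_ip_i (re_ipC _ x) ip_ix; ring.
Qed.

Let nrm_eq0 x : nrm x = 0 -> x = 0.
Proof.
move/complexI => h; apply: re_ip_eq0.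
by rewrite -[LHS]sqr_sqrtr ?re_ip_ge0 // h expr0n.
Qed.

HB.instance Definition _ := Lmodule_isNormed.Build R[i] H nrmD nrmZ nrm_eq0.

Let nrm_lt x (e : R) : 0 < e -> (`|x| < e%:C) = (re_ip x x < e ^+ 2).
Proof.
move=> e0; rewrite ltcR -[X in _ = (X < _)]sqr_sqrtr ?re_ip_ge0 //.
by rewrite ltr_sqr // nnegrE ?sqrtr_ge0 // ltW.
Qed.

Let pos_real (e : R[i]) : 0 < e -> exists2 r : R, 0 < r & e = r%:C.
Proof.
move=> e0; have er : e = (complex.Re e)%:C by rewrite RRe_real // ger0_real // ltW.
by exists (complex.Re e); rewrite // er ltcR in e0.
Qed.

(** Reduction of Cauchy filters to sequences: [u n] is the centre of a ball of radius [1 / (n + 1)]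
    belonging to [F]. Two such balls meet, so [u] is fundamental, and its limit is the limit of
    [F]. *)
Let complete (F : set_system H) : ProperFilter F -> cauchy F -> cvg F.
Proof.
move=> FF /cauchyP cF; apply/cvg_ex.
have ex n : exists x, F (ball x (n.+1%:R^-1 : R)%:C).
  by apply: cF; rewrite ltcR invr_gt0.
have [u hu] := choice ex.
have close m n (e : R) : m.+1%:R^-1 < e / 2 -> n.+1%:R^-1 < e / 2 -> `|u m - u n| < e%:C.
  move=> me ne; have [y] := filter_ex (filterI (hu m) (hu n)).
  rewrite -ball_normE /= => -[hm hn].
  rewrite -(subrKA y) (le_lt_trans (ler_normD _ _)) // [X in _ + X]distrC.
  rewrite (lt_trans (ltrD hm hn)) // -rmorphD ltcR.
  by rewrite [ltRHS]splitr ltrD.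
have [e e0|l hl] := @re_ip_complete u.
  have s0 : 0 < Num.sqrt e by rewrite sqrtr_gt0.
  have [N hN] := @invS_small _ (Num.sqrt e / 2) ltac:(by rewrite divr_gt0).
  exists N => m n Nm Nn; rewrite -(sqr_sqrtr (ltW e0)) -nrm_lt //.
  by apply: close; apply: hN.
exists l; apply/cvgrPdist_lt => _ /pos_real [e e0 ->].
have e20 : 0 < e / 2 by rewrite divr_gt0.
have [N hN] := hl _ (exprn_gt0 2 e20); have [N' hN'] := invS_small e20.
have := hN (maxn N N') (leq_maxl _ _); have := hN' (maxn N N') (leq_maxr _ _).
set n := maxn _ _ => h1 h2; apply: filterS (hu n) => y; rewrite -ball_normE /= => h3.
rewrite -(subrKA (u n)) (le_lt_trans (ler_normD _ _)) //.
have -> : e%:C = (e / 2)%:C + (e / 2)%:C by rewrite -rmorphD; congr _%:C; field.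
apply: ltrD; first by rewrite distrC nrm_lt.
by rewrite (lt_trans h3) // ltcR.
Qed.

HB.instance Definition _ := Uniform_isComplete.Build H complete.

Let ip x y : R[i] := re_ip x y +i* re_ip x ('i *: y).

Let ipZ (a : R[i]) x y : ip (a *: x) y = a * ip x y.
Proof.
rewrite /ip cE !re_ipDl !re_ipZl re_ip_i ip_il; case: a => p q /=.
by apply/eqP; rewrite eq_complex /=; apply/andP; split; apply/eqP; ring.
Qed.

Let ipC x y : ip x y = (ip y x)^*.
Proof.
rewrite /ip /= (re_ipC x y); congr (_ +i* _).
by rewrite re_ipC ip_il.
Qed.

Let ipD x y z : ip (x + y) z = ip x z + ip y z.
Proof. by rewrite /ip !re_ipDl. Qed.

Let ip_bilinear :
  bilinear_for (GRing.Scale.Law.clone _ _ *%R _)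
    (GRing.Scale.Law.clone _ _ (@Num.conj R[i] \; *%R) _) ip.
Proof.
split=> [z|z] a x y /=; first by rewrite ipD ipZ.
by rewrite ipC ipD ipZ rmorphD rmorphM /= -!ipC.
Qed.

HB.instance Definition _ := bilinear_isBilinear.Build R[i] H H R[i] _ _ ip ip_bilinear.

Let ip_hermitian x y : ip x y = (-1) ^+ false * Num.conj (ip y x).
Proof. by rewrite expr0 mul1r ipC. Qed.

HB.instance Definition _ := isHermitianSesquilinear.Build R[i] H false _ ip ip_hermitian.

Let ip_norm x : ip x x = `|x| ^+ 2.
Proof. by rewrite /ip ip_ix -rmorphXn /= sqr_sqrtr ?re_ip_ge0. Qed.

Let ip_gt0 x : x != 0 -> 0 < ip x x.
Proof. by move=> x0; rewrite ip_norm exprn_gt0 // normr_gt0. Qed.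

HB.instance Definition _ := isDotProduct.Build R[i] H ip ip_gt0.

HB.instance Definition _ := CompleteNormedModule_isHilbert.Build R H ip_norm.

HB.end.

Lemma tends_sqr (R : realType) (H : hilbertType R) (u : nat -> H) (l : H) :
  tends u l <-> (forall e : R, 0 < e -> exists N, forall n, (N <= n)%N ->
    rinner (u n - l) (u n - l) < e).
Proof.
split=> h e e0.
  have s0 : 0 < Num.sqrt e by rewrite sqrtr_gt0.
  have [N hN] := h _ s0; exists N => n /hN.
  by rewrite rinnerE -[e in _ -> _ < e](sqr_sqrtr (ltW e0)) ltr_sqr // nnegrE ?rnorm_ge0 ?ltW.
have [N hN] := h _ (exprn_gt0 2 e0); exists N => n /hN.
by rewrite rinnerE ltr_sqr // nnegrE ?rnorm_ge0 ?ltW.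
Qed.

Lemma fundamental_sqr (R : realType) (H : hilbertType R) (u : nat -> H) :
  (forall e : R, 0 < e -> exists N, forall m n, (N <= m)%N -> (N <= n)%N ->
    rinner (u m - u n) (u m - u n) < e) -> fundamental u.
Proof.
move=> h e e0; have [N hN] := h _ (exprn_gt0 2 e0); exists N => m n Nm Nn.
by have := hN m n Nm Nn; rewrite rinnerE ltr_sqr // nnegrE ?rnorm_ge0 ?ltW.
Qed.

Lemma rinner_ge0 (R : realType) (H : hilbertType R) (x : H) : 0 <= rinner x x.
Proof. by rewrite rinnerE sqr_ge0. Qed.

Lemma rinner_eq0 (R : realType) (H : hilbertType R) (x : H) : rinner x x = 0 -> x = 0.
Proof. by rewrite rinnerE => /eqP; rewrite sqrf_eq0 => /eqP /rnorm0_eq0. Qed.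

Lemma rinner_i (R : realType) (H : hilbertType R) (x y : H) :
  rinner ('i *: x) ('i *: y) = rinner x y.
Proof.
rewrite rinnerZi scalerA -expr2 sqr_i.
by rewrite -(rmorphN1 (real_complex R)) rinnerZr mulN1r opprK.
Qed.

(* The product [A * B] itself already carries the max norm. *)
Definition hsum (R : realType) (A B : hilbertType R) : Type := (A * B)%type.

Section HilbertSum.
Variables (R : realType) (A B : hilbertType R).

HB.instance Definition _ := GRing.Lmodule.copy (hsum A B) (A * B)%type.

Let ip (x y : hsum A B) : R := rinner x.1 y.1 + rinner x.2 y.2.

Let ipDl x y z : ip (x + y) z = ip x z + ip y z.
Proof. by rewrite /ip !rinnerDl addrACA. Qed.

Let ipZl (t : R) x y : ip (t%:C *: x) y = t * ip x y.
Proof. by rewrite /ip !rinnerZl mulrDr. Qed.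

Let ipC x y : ip x y = ip y x.
Proof. by rewrite /ip rinnerC (rinnerC x.2). Qed.

Let ip_i (x y : hsum A B) : ip ('i *: x) ('i *: y) = ip x y.
Proof. by rewrite /ip !rinner_i. Qed.

Let ip_ge0 x : 0 <= ip x x.
Proof. by rewrite addr_ge0 // rinner_ge0. Qed.

Let ip_eq0 x : ip x x = 0 -> x = 0.
Proof.
case: x => a b /eqP; rewrite /ip paddr_eq0 ?rinner_ge0 //=.
by move=> /andP[/eqP/rinner_eq0 -> /eqP/rinner_eq0 ->].
Qed.

Let ip_complete (u : nat -> hsum A B) :
  (forall e : R, 0 < e -> exists N, forall m n, (N <= m)%N -> (N <= n)%N ->
    ip (u m - u n) (u m - u n) < e) ->
  exists l, forall e : R, 0 < e -> exists N, forall n, (N <= n)%N ->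
    ip (u n - l) (u n - l) < e.
Proof.
move=> hu.
have /fundamental_tends [a /tends_sqr ha] : fundamental (fun n => (u n).1).
  apply: fundamental_sqr => e /hu [N hN]; exists N => m n Nm Nn.
  by apply: le_lt_trans (hN m n Nm Nn); rewrite /ip lerDl rinner_ge0.
have /fundamental_tends [b /tends_sqr hb] : fundamental (fun n => (u n).2).
  apply: fundamental_sqr => e /hu [N hN]; exists N => m n Nm Nn.
  by apply: le_lt_trans (hN m n Nm Nn); rewrite /ip lerDr rinner_ge0.
exists (a, b) => e e0; have e20 : 0 < e / 2 by rewrite divr_gt0.
have [N hN] := ha _ e20; have [N' hN'] := hb _ e20.
exists (maxn N N') => n; rewrite geq_max => /andP[/hN h /hN' h'].
by rewrite /ip [ltRHS]splitr ltrD.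
Qed.

HB.instance Definition _ := Lmodule_isHilbert.Build R (hsum A B)
  ipDl ipZl ipC ip_i ip_ge0 ip_eq0 ip_complete.

Definition hpair (a : A) (b : B) : hsum A B := (a, b).
Definition hfst (x : hsum A B) : A := x.1.
Definition hsnd (x : hsum A B) : B := x.2.

Lemma rinner_hsum (x y : hsum A B) :
  rinner x y = rinner (hfst x) (hfst y) + rinner (hsnd x) (hsnd y).
Proof. by []. Qed.

Lemma hsum_ext (x y : hsum A B) : hfst x = hfst y -> hsnd x = hsnd y -> x = y.
Proof. by case: x => a b; case: y => c d /= -> ->. Qed.

Fact hfst_linear : linear hfst. Proof. by []. Qed.
HB.instance Definition _ := GRing.isLinear.Build R[i] (hsum A B) A *:%R hfst hfst_linear.
Fact hsnd_linear : linear hsnd. Proof. by []. Qed.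
HB.instance Definition _ := GRing.isLinear.Build R[i] (hsum A B) B *:%R hsnd hsnd_linear.

End HilbertSum.

(** * Square-summable sequences *)

Section SquareSummable.
Variables (R : realType) (F : hilbertType R).
Implicit Types (f g : nat -> F).

Definition psum f g (n : nat) : R := \sum_(i < n) rinner (f i) (g i).

Definition square_summable f := exists C : R, forall n, psum f f n <= C.

Lemma psum_nondecreasing f : nondecreasing_seq (psum f f).
Proof.
apply/nondecreasing_seqP => n; rewrite /psum big_ord_recr /= lerDl; exact: rinner_ge0.
Qed.

Lemma is_cvg_psum_diag f : square_summable f -> cvgn (psum f f).
Proof.
move=> [C hC]; apply: nondecreasing_is_cvgn; first exact: psum_nondecreasing.
by exists C => _ [n _ <-].
Qed.

Lemma square_summableD f g :
  square_summable f -> square_summable g -> square_summable (f \+ g).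
Proof.
move=> [C hC] [D hD]; exists (2 * (C + D)) => n.
apply: (@le_trans _ _ (2 * (psum f f n + psum g g n))); last first.
  by rewrite ler_wpM2l // lerD.
rewrite /psum -big_split mulr_sumr /=; apply: ler_sum => i _.
have := rinner_ge0 (f i - g i); rewrite !rinnerS (rinnerC (g i)); lra.
Qed.

Lemma square_summableZ (a : R[i]) f :
  square_summable f -> square_summable (a \*: f).
Proof.
move=> [C hC]; exists (complex.Re `|a| ^+ 2 * C) => n.
apply: (@le_trans _ _ (complex.Re `|a| ^+ 2 * psum f f n)); last first.
  by rewrite ler_wpM2l // sqr_ge0.
rewrite /psum mulr_sumr ler_sum // => i _ /=; rewrite !rinnerE -exprMn.
suff -> : rnorm (a *: f i) = complex.Re `|a| * rnorm (f i) by [].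
apply: (@complexI R); rewrite -rnormE normrZ rnormE rmorphM.
by congr (_ * _); rewrite -[LHS]RRe_real ?normr_real.
Qed.

(** By polarization, the mixed partial sums are differences of diagonal ones, which are monotone and
    bounded. *)
Lemma is_cvg_psum f g : square_summable f -> square_summable g -> cvgn (psum f g).
Proof.
move=> hf hg.
have hm : square_summable (f \+ (-1 : R[i]) \*: g).
  exact/square_summableD/square_summableZ.
have -> : psum f g = (fun n => 4^-1 * (psum (f \+ g) (f \+ g) n
    - psum (f \+ (-1 : R[i]) \*: g) (f \+ (-1 : R[i]) \*: g) n)).
  apply/funext => n; rewrite /psum -sumrB mulr_sumr; apply: eq_bigr => i _ /=.
  by rewrite scaleN1r !rinnerS (rinnerC (g i)); field.
apply: is_cvgMr; apply: is_cvgB.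
  exact/is_cvg_psum_diag/square_summableD.
exact: is_cvg_psum_diag.
Qed.

Definition ell2_pred : {pred nat -> F} := fun f => `[< square_summable f >].

Fact ell2_submod_closed : submod_closed ell2_pred.
Proof.
split; first by apply/asboolP; exists 0 => n; rewrite /psum big1 // => i _; rewrite rinner0l.
by move=> a f g /asboolP hf /asboolP hg; apply/asboolP/square_summableD/hg/square_summableZ.
Qed.

HB.instance Definition _ :=
  GRing.isSubmodClosed.Build R[i] (nat -> F) ell2_pred ell2_submod_closed.

Record ell2 := Ell2 { ell2_fun :> nat -> F ; ell2_funP : ell2_fun \in ell2_pred }.

HB.instance Definition _ := [isSub for ell2_fun].
HB.instance Definition _ := [Choice of ell2 by <:].
HB.instance Definition _ := [SubChoice_isSubLmodule of ell2 by <:].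

Lemma ell2_square_summable (x : ell2) : square_summable x.
Proof. by apply/asboolP; exact: ell2_funP. Qed.

Lemma ell2_ext (x y : ell2) : (forall n, x n = y n) -> x = y.
Proof. by move=> h; apply: val_inj; apply/funext. Qed.

Lemma ell2D (x y : ell2) n : (x + y) n = x n + y n. Proof. by []. Qed.

Lemma ell2Z (a : R[i]) (x : ell2) n : (a *: x) n = a *: x n. Proof. by []. Qed.

(** Being total, with value 0 off the square-summable sequences, it lets operators on [ell2] be
    defined by formulas first and their summability be checked afterwards, through [to_ell2E]. *)
Definition to_ell2 (f : nat -> F) : ell2 := insubd 0 f.

Lemma to_ell2E f n : square_summable f -> to_ell2 f n = f n.
Proof. by move=> h; rewrite [ell2_fun _]insubdK //; apply/asboolP. Qed.

End SquareSummable.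

Section Ell2Hilbert.
Variables (R : realType) (F : hilbertType R).
Notation E := (ell2 F).
Implicit Types x y z : E.

Let ip x y : R := limn (psum x y).

Let ip_cvg x y : psum x y @ \oo --> ip x y.
Proof. by apply: is_cvg_psum; exact: ell2_square_summable. Qed.

Let ipE x y (l : R) : psum x y @ \oo --> l -> ip x y = l.
Proof. by move=> h; apply: cvg_lim. Qed.

Let ipDl x y z : ip (x + y) z = ip x z + ip y z.
Proof.
apply: ipE; have -> : psum (x + y) z = psum x z \+ psum y z.
  by apply/funext => n; rewrite /psum /= -big_split; apply: eq_bigr => i _ /=; rewrite -rinnerDl.
by apply: cvgD; exact: ip_cvg.
Qed.

Let ipZl (t : R) x y : ip (t%:C *: x) y = t * ip x y.
Proof.
apply: ipE; have -> : psum (t%:C *: x) y = (fun n => t * psum x y n).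
  by apply/funext => n; rewrite /psum mulr_sumr; apply: eq_bigr => i _; rewrite -rinnerZl.
by apply: cvgMr; exact: ip_cvg.
Qed.

Let ipC x y : ip x y = ip y x.
Proof.
apply: ipE; have -> : psum x y = psum y x; last exact: ip_cvg.
by apply/funext => n; apply: eq_bigr => i _; rewrite rinnerC.
Qed.

Let ip_i x y : ip ('i *: x) ('i *: y) = ip x y.
Proof.
apply: ipE; have -> : psum ('i *: x) ('i *: y) = psum x y; last exact: ip_cvg.
by apply/funext => n; apply: eq_bigr => i _; rewrite -[RHS]rinner_i.
Qed.

Let psum_le x n : psum x x n <= ip x x.
Proof. by apply: nondecreasing_cvgn_le; [exact: psum_nondecreasing | exact: ip_cvg]. Qed.

Let ip_ge0 x : 0 <= ip x x.
Proof. by apply: le_trans (psum_le x 0); rewrite /psum big_ord0. Qed.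

Let coord_le x n : rinner (x n) (x n) <= ip x x.
Proof.
apply: le_trans (psum_le x n.+1); rewrite /psum big_ord_recr /= lerDr.
by apply: sumr_ge0 => i _; exact: rinner_ge0.
Qed.

Let ip_eq0 x : ip x x = 0 -> x = 0.
Proof.
move=> h; apply: ell2_ext => n; apply: rinner_eq0; apply/eqP.
by rewrite eq_le rinner_ge0 andbT -h coord_le.
Qed.

(** Each finite section of [|u n - l|^2] is the limit over [m] of the same section of
    [|u n - u m|^2], which stays below [e]. The bound is uniform in [K], so it serves both for the
    summability of [l] and for convergence in norm. *)
Let tail_le (u : nat -> E) (l : nat -> F) (N : nat) (e : R) :
  (forall k, tends (fun n => u n k) (l k)) ->
  (forall m n, (N <= m)%N -> (N <= n)%N -> ip (u m - u n) (u m - u n) < e) ->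
  forall n K, (N <= n)%N -> psum (u n \- l) (u n \- l) K <= e.
Proof.
move=> hl hN n K Nn.
have sq k : (fun m => rinner (u n k - u m k) (u n k - u m k)) @ \oo -->
    rinner (u n k - l k) (u n k - l k).
  have -> : (fun m => rinner (u n k - u m k) (u n k - u m k)) =
      (fun m => rnorm (u n k - u m k) * rnorm (u n k - u m k)).
    by apply/funext => m; rewrite rinnerE expr2.
  rewrite rinnerE expr2.
  suff h : (fun m => rnorm (u n k - u m k)) @ \oo --> rnorm (u n k - l k) by exact: cvgM.
  apply/cvgrPdist_lt => r r0; have [M hM] := hl k r r0.
  exists M => // m /= /hM; apply: le_lt_trans; rewrite ler_norml.
  have := rnormD (u n k - u m k) (u m k - l k); rewrite subrKA.
  have := rnormD (u n k - l k) (l k - u m k); rewrite subrKA (rnormB (l k)).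
  move=> *; apply/andP; split; lra.
have cv : (fun m => psum (u n \- u m) (u n \- u m) K) @ \oo --> psum (u n \- l) (u n \- l) K.
  rewrite /psum; elim: K => [|K IH].
    under eq_fun do rewrite big_ord0.
    by rewrite big_ord0; exact: cvg_cst.
  under eq_fun do rewrite big_ord_recr /=.
  by rewrite big_ord_recr /=; apply: cvgD.
apply: (cvgr_to_le cv); exists N => // m /= Nm.
by apply: le_trans (ltW (hN n m Nn Nm)); exact: (psum_le (u n - u m) K).
Qed.

Let ip_complete (u : nat -> E) :
  (forall e : R, 0 < e -> exists N, forall m n, (N <= m)%N -> (N <= n)%N ->
    ip (u m - u n) (u m - u n) < e) ->
  exists l, forall e : R, 0 < e -> exists N, forall n, (N <= n)%N ->
    ip (u n - l) (u n - l) < e.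
Proof.
move=> hu.
have ex k : exists l, tends (fun n => u n k) l.
  apply: fundamental_tends; apply: fundamental_sqr => e /hu [N hN].
  by exists N => m n Nm Nn; apply: le_lt_trans (hN m n Nm Nn); exact: (coord_le (u m - u n) k).
have [l hl] := choice ex.
have [N hN] := hu 1 ltr01.
have sl : square_summable l.
  (* [tail_le] controls only [u N - l]; summability of [l] follows by subtracting this from
     [u N]. *)
  have -> : l = u N \+ (-1 : R[i]) \*: (u N \- l).
    by apply/funext => k /=; rewrite scaleN1r opprB addrC subrK.
  apply: square_summableD; first exact: ell2_square_summable.
  by apply: square_summableZ; exists 1 => K; exact: (tail_le hl hN).
exists (to_ell2 l) => e e0.
have [M hM] := hu _ (divr_gt0 e0 (ltr0n _ 2)).
exists M => n Mn; apply: (@le_lt_trans _ _ (e / 2)); last first.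
  by rewrite ltr_pdivrMr // mulr_natr mulr2n ltrDl.
set w := u n - to_ell2 l; have cw := @ip_cvg w w.
apply: (cvgr_to_le cw); exists 0%N => // K _.
have -> : psum w w K = psum (u n \- l) (u n \- l) K.
  apply: eq_bigr => k _; rewrite /w.
  have -> : (u n - to_ell2 l) k = u n k - to_ell2 l k by [].
  by rewrite to_ell2E.
exact: (tail_le hl hM).
Qed.

HB.instance Definition _ := Lmodule_isHilbert.Build R E
  ipDl ipZl ipC ip_i ip_ge0 ip_eq0 ip_complete.

Lemma cvg_psum x y : psum x y @ \oo --> rinner x y.
Proof. exact: ip_cvg. Qed.

Lemma cvg_psum_eq x y (l : R) : psum x y @ \oo --> l -> rinner x y = l.
Proof. exact: ipE. Qed.

Lemma ell2_orthogonal x y : (forall n, rinner (x n) (y n) = 0) -> rinner x y = 0.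
Proof.
move=> h; apply: ipE; have -> : psum x y = fun=> 0; last exact: cvg_cst.
by apply/funext => n; rewrite /psum big1.
Qed.

End Ell2Hilbert.

Section Ell2Maps.
Variables (R : realType) (F : hilbertType R).
Implicit Types (A : F -> F) (a : F) (x : ell2 F).

Definition ell2_map A x : ell2 F := to_ell2 (A \o x).

Definition ell2_cons a x : ell2 F := to_ell2 (fun n => if n is m.+1 then x m else a).

Lemma ell2_mapE A x n : contractive A -> ell2_map A x n = A (x n).
Proof.
move=> /contractiveE hA; rewrite /ell2_map to_ell2E //.
have [C hC] := ell2_square_summable x; exists C => k; apply: le_trans (hC k).
by apply: ler_sum => i _; rewrite !rinnerE /= -rnorm_le_sqr.
Qed.

Let cons_psum a x n :
  psum (fun n => if n is m.+1 then x m else a) (fun n => if n is m.+1 then x m else a) n.+1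
  = rinner a a + psum x x n.
Proof. by rewrite /psum big_ord_recl. Qed.

Let cons_summable a x : square_summable (fun n => if n is m.+1 then x m else a).
Proof.
have [C hC] := ell2_square_summable x; exists (rinner a a + C) => -[|n].
  by rewrite /psum big_ord0 addr_ge0 ?rinner_ge0 // (le_trans _ (hC 0)) // /psum big_ord0.
by rewrite cons_psum lerD2l.
Qed.

Lemma ell2_cons0 a x : ell2_cons a x 0%N = a.
Proof. by rewrite /ell2_cons to_ell2E. Qed.

Lemma ell2_consS a x n : ell2_cons a x n.+1 = x n.
Proof. by rewrite /ell2_cons to_ell2E. Qed.

Lemma rinner_ell2_map A x : isometric A ->
  rinner (ell2_map A x) (ell2_map A x) = rinner x x.
Proof.
move=> hA; apply: cvg_psum_eq.
have -> : psum (ell2_map A x) (ell2_map A x) = psum x x; last exact: cvg_psum.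
apply/funext => n; apply: eq_bigr => i _; rewrite ell2_mapE; last exact: isometric_contractive.
by rewrite !rinnerE; move/isometricE: hA => ->.
Qed.

Lemma rinner_ell2_cons a x :
  rinner (ell2_cons a x) (ell2_cons a x) = rinner a a + rinner x x.
Proof.
(* The empty partial sum lacks the term of [a], so the sequence is shifted by one before
   comparing. *)
apply: cvg_psum_eq; rewrite -cvg_shiftS.
have -> : [sequence psum (ell2_cons a x) (ell2_cons a x) n.+1]_n
    = (fun n => rinner a a + psum x x n).
  apply/funext => n; rewrite -cons_psum; apply: eq_bigr => i _.
  by rewrite /ell2_cons to_ell2E.
by apply: cvgD; [exact: cvg_cst | exact: cvg_psum].
Qed.

End Ell2Maps.

(** * Defect operators *)

Lemma cvg_seq_unique (R : realType) (f : nat -> R) (a b : R) :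
  f @ \oo --> b -> f @ \oo --> a -> a = b.
Proof.
by move=> hb ha; rewrite -(cvg_lim (@Rhausdorff R) ha) -(cvg_lim (@Rhausdorff R) hb).
Qed.

Section TendsTheory.
Variables (R : realType) (H : hilbertType R).
Implicit Types (u v : nat -> H) (l : H).

Lemma tends_cst l : tends (fun=> l) l.
Proof. by move=> e e0; exists 0%N => n _; rewrite subrr rnorm0. Qed.

Lemma tendsD u v l l' : tends u l -> tends v l' -> tends (u \+ v) (l + l').
Proof.
move=> h h' e e0; have e2 : 0 < e / 2 by rewrite divr_gt0.
have [N hN] := h _ e2; have [N' hN'] := h' _ e2.
exists (maxn N N') => n; rewrite geq_max => /andP[/hN a /hN' b] /=.
rewrite opprD addrACA (le_lt_trans (rnormD _ _)) // [ltRHS]splitr; exact: ltrD.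
Qed.

Lemma tends_lipschitz (K : hilbertType R) (A : {linear H -> K}) (C : R) u l :
  (forall x, rnorm (A x) <= C * rnorm x) -> tends u l -> tends (A \o u) (A l).
Proof.
move=> hA h e e0.
have C1 : 0 < `|C| + 1 by rewrite ltr_wpDl.
have [N hN] := h _ (divr_gt0 e0 C1).
exists N => n /hN; rewrite ltr_pdivlMr // => hn /=; rewrite -linearB.
apply: le_lt_trans hn; rewrite (le_trans (hA _)) // mulrC ler_wpM2l ?rnorm_ge0 //.
by rewrite (le_trans (ler_norm _)) // lerDl.
Qed.

Lemma rnormZc (a : R[i]) (x : H) : rnorm (a *: x) = complex.Re `|a| * rnorm x.
Proof.
apply: (@complexI R); rewrite -rnormE normrZ rnormE rmorphM.
by congr (_ * _); rewrite -[LHS]RRe_real ?normr_real.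
Qed.

Lemma tendsZ (a : R[i]) u l : tends u l -> tends (a \*: u) (a *: l).
Proof.
apply: (@tends_lipschitz _ (a \*: idfun) (complex.Re `|a|)) => x /=.
by rewrite rnormZc.
Qed.

Lemma cvg_rinner u l x : tends u l -> (fun n => rinner (u n) x) @ \oo --> rinner l x.
Proof.
move=> h; apply/cvgrPdist_lt => e e0.
have x1 : 0 < rnorm x + 1 by rewrite ltr_wpDl // rnorm_ge0.
have [N hN] := h _ (divr_gt0 e0 x1); exists N => // n /= /hN.
rewrite ltr_pdivlMr // => hn; apply: le_lt_trans hn.
rewrite -rinnerNl -rinnerDl (le_trans (rinner_norm _ _)) // rnormB.
by rewrite ler_wpM2l ?rnorm_ge0 // lerDl.
Qed.

End TendsTheory.

(* With [y = 1 - sqrt (1 - q)], the equation [y = (q + y^2) / 2] is solved by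
   iteration; the iterates [c n] at [q = 1] dominate the operator iterates [Y n]. *)
Section SquareRootIteration.
Variables (R : realType) (H : hilbertType R) (Q : {linear H -> H}).
Hypothesis Q_sym : forall u v, rinner (Q u) v = rinner u (Q v).
Hypothesis Q_le : forall x, rnorm (Q x) <= rnorm x.
Variable Y : nat -> {linear H -> H}.
Hypothesis Y0 : forall x, Y 0 x = 0.
Hypothesis YS : forall n x, Y n.+1 x = (2^-1)%:C *: (Q x + Y n (Y n x)).

Let Fixpoint c (n : nat) : R := if n is m.+1 then 2^-1 * (1 + c m ^+ 2) else 0.

Let cS n : c n.+1 = 2^-1 * (1 + c n ^+ 2). Proof. by []. Qed.

Let c_ge0 n : 0 <= c n.
Proof. by case: n => //= n; rewrite mulr_ge0 ?invr_ge0 ?addr_ge0 ?sqr_ge0. Qed.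

Let c_le1 n : c n <= 1.
Proof. elim: n => [|n IH] //=; have := c_ge0 n; nra. Qed.

Let c_le n : c n <= c n.+1.
Proof. by have := sqr_ge0 (c n - 1); rewrite /=; nra. Qed.

Let Y_sym n u v : rinner (Y n u) v = rinner u (Y n v).
Proof.
elim: n u v => [|n IH] u v; first by rewrite !Y0 rinner0l rinner0r.
by rewrite !YS !rinnerS Q_sym !IH.
Qed.

(** Used twice: with [B = Q], and then with [B] an iterate, which gives that all iterates
    commute. *)
Let comm_Y (B : {linear H -> H}) : (forall x, B (Q x) = Q (B x)) ->
  forall n x, B (Y n x) = Y n (B x).
Proof.
move=> hB; elim=> [|n IH] x; first by rewrite !Y0 linear0.
by rewrite !YS linearZ linearD hB !IH.
Qed.

Let Y_comm m n x : Y m (Y n x) = Y n (Y m x).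
Proof. by apply: comm_Y => {}x; apply/esym/comm_Y. Qed.

Let Y_le n x : rnorm (Y n x) <= c n * rnorm x.
Proof.
elim: n x => [|n IH] x; first by rewrite Y0 rnorm0 mul0r.
rewrite YS rnormZ ger0_norm ?invr_ge0 //= -mulrA ler_wpM2l ?invr_ge0 //.
rewrite (le_trans (rnormD _ _)) // mulrDl mul1r lerD ?Q_le //.
by rewrite (le_trans (IH _)) // expr2 -mulrA ler_wpM2l.
Qed.

Let Y_contract n x : rnorm (Y n x) <= 1 * rnorm x.
Proof. by rewrite (le_trans (Y_le _ _)) // ler_wpM2r ?rnorm_ge0. Qed.

(** Since the iterates commute, [Y n.+2 - Y n.+1] is half of [(Y n.+1 + Y n) (Y n.+1 - Y n)]. The
    increments of [c] obey the same recursion, so the bound propagates. *)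
Let Y_step n x : rnorm (Y n.+1 x - Y n x) <= (c n.+1 - c n) * rnorm x.
Proof.
elim: n x => [|n IH] x; first by rewrite Y0 !subr0 Y_le.
set d := Y n.+1 x - Y n x.
have -> : Y n.+2 x - Y n.+1 x = (2^-1)%:C *: (Y n.+1 d + Y n d).
  rewrite [Y n.+2 x]YS [in X in _ - X]YS -scalerBr; congr (_ *: _).
  by rewrite /d !linearB /= (Y_comm n n.+1) opprD addrACA subrr add0r subrKA.
have h1 := rnormD (Y n.+1 d) (Y n d).
have h2 := Y_le n.+1 d; have h3 := Y_le n d.
have h4 := ler_wpM2l (addr_ge0 (c_ge0 n.+1) (c_ge0 n)) (IH x).
rewrite rnormZ ger0_norm ?invr_ge0 //.
have -> : c n.+2 - c n.+1 = 2^-1 * ((c n.+1 + c n) * (c n.+1 - c n)).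
  have := cS n.+1; have := cS n; move: (c n.+2) (c n.+1) (c n) => p q r -> ->; by field.
by rewrite -!mulrA ler_wpM2l ?invr_ge0 // mulrA; rewrite -/d in h4; lra.
Qed.

Let c_mono m n : (m <= n)%N -> c m <= c n.
Proof. by move: m n; apply/nondecreasing_seqP. Qed.

Let Y_diff m k x : rnorm (Y (m + k) x - Y m x) <= (c (m + k) - c m) * rnorm x.
Proof.
elim: k => [|k IH]; first by rewrite addn0 !subrr mul0r rnorm0.
rewrite addnS -(subrKA (Y (m + k) x)) (le_trans (rnormD _ _)) //.
have := Y_step (m + k) x; lra.
Qed.

(** The tails are dominated by those of [c], which is increasing and bounded. As [1 - c n] decays
    only like [2 / n], no geometric rate is available and the supremum of [c] is used instead. *)
Let Y_fundamental x : fundamental (fun n => Y n x).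
Proof.
have x1 : 0 < rnorm x + 1 by rewrite ltr_wpDl // rnorm_ge0.
have hs : has_sup (range c) by split; [exists (c 0), 0%N | exists 1 => _ [n _ <-]].
move=> e e0; have e1 : 0 < e / 2 / (rnorm x + 1) by rewrite !divr_gt0.
have [_ [N _ <-] hN] := sup_adherent e1 hs.
have tail n : (N <= n)%N -> rnorm (Y n x - Y N x) < e / 2.
  move=> /subnKC <-; apply: le_lt_trans (Y_diff _ _ _) _.
  set k := (N + (n - N))%N; have h : c k <= sup (range c) by apply: sup_upper_bound => //; exists k.
  have ck : c N <= c k by apply: c_mono; apply: leq_addr.
  move: hN; rewrite ltrBlDr -ltrBlDl => hN.
  have h' : c k - c N < e / 2 / (rnorm x + 1) by lra.
  move: h'; rewrite ltr_pdivlMr //; have := rnorm_ge0 x; nra.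
exists N => m n /tail hm /tail hn; rewrite -(subrKA (Y N x)).
rewrite (le_lt_trans (rnormD _ _)) // (rnormB (Y N x)); lra.
Qed.

Lemma square_root_iteration : exists Z : {linear H -> H},
  [/\ forall u v, rinner (Z u) v = rinner u (Z v) &
      forall x, 2%:R *: Z x = Q x + Z (Z x)].
Proof.
have [z hz] := choice (fun x => fundamental_tends (Y_fundamental x)).
have z_lin : linear z.
  move=> a u v; apply: tends_unique (hz _) _.
  have -> : (fun n => Y n (a *: u + v)) = (a \*: (fun n => Y n u)) \+ (fun n => Y n v).
    by apply/funext => n /=; rewrite linearP.
  by apply: tendsD => //; apply: tendsZ.
have [Z hZ] := linear_of z_lin; exists Z.
have {}hz x : tends (fun n => Y n x) (Z x) by rewrite hZ; exact: hz.
split=> [u v|x].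
  have h : (fun n => rinner (Y n v) u) @ \oo --> rinner (Z v) u by exact: cvg_rinner.
  rewrite [RHS]rinnerC; apply: (cvg_seq_unique h).
  rewrite (_ : (fun n => rinner (Y n v) u) = (fun n => rinner (Y n u) v)).
    exact: cvg_rinner.
  by apply/funext => n; rewrite Y_sym rinnerC.
apply: (@tends_unique _ _ (fun n => 2%:R *: Y n.+1 x)).
  apply: tendsZ => e /(hz x) [N hN]; exists N => n Nn; apply: hN; exact: leqW.
have -> : (fun n => 2%:R *: Y n.+1 x) = (fun=> Q x) \+ (fun n => Y n (Y n x)).
  apply/funext => n /=; rewrite YS scalerA -[2%:R](rmorph_nat (real_complex R)) -rmorphM.
  by rewrite divff ?pnatr_eq0 // scale1r.
apply: tendsD; first exact: tends_cst.
(* Both the operator and its argument vary with [n]; the first summand tends to 0 because every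
   [Y n] is a contraction. *)
have -> : (fun n => Y n (Y n x)) = (fun n => Y n (Y n x - Z x)) \+ (fun n => Y n (Z x)).
  by apply/funext => n /=; rewrite -linearD subrK.
rewrite -[Z (Z x)]add0r; apply: tendsD => // e e0.
have [N hN] := hz x e e0; exists N => n /hN; rewrite subr0; apply: le_lt_trans.
by have := Y_contract n (Y n x - Z x); rewrite mul1r.
Qed.

End SquareRootIteration.

(** With [Q] the product of [adjoint T] and [T], the limit [Z] plays the role of [1 - sqrt (1 - Q)].
    Hence [D = 1 - Z] is symmetric with [D^2 = 1 - 2 Z + Z^2 = 1 - Q]. *)
Lemma defect_operator (R : realType) (H : hilbertType R) (T : {linear H -> H}) :
  contractive T ->
  exists D : {linear H -> H}, forall x, rnorm (D x) ^+ 2 = rnorm x ^+ 2 - rnorm (T x) ^+ 2.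
Proof.
move=> hT; have hA := adjoint_contractive hT.
have [A' hA'] := linear_of (adjoint_linear hT).
pose Q : {linear H -> H} := A' \o T.
have QE x : Q x = adjoint T (T x) by rewrite /Q /= hA'.
have step (f : {linear H -> H}) : exists g : {linear H -> H},
    forall x, g x = (2^-1)%:C *: (Q x + f (f x)).
  by exists ((2^-1)%:C \*: (Q \+ (f \o f))).
have [s hs] := choice step.
pose Y n : {linear H -> H} := iter n s \0.
have [] := @square_root_iteration R H Q _ _ Y.
- by move=> u v; rewrite !QE -rinner_adjoint // rinnerC -rinner_adjoint // rinnerC.
- move=> x; rewrite QE; move/contractiveE: hA => hA; move/contractiveE: hT => hT'.
  exact: le_trans (hA _) (hT' _).
- by [].
- by move=> n x; rewrite /Y /= hs.
move=> Z [Z_sym Z_eq]; exists (idfun \- Z) => x /=.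
have : rinner x (2%:R *: Z x) = rinner x (Q x) + rinner x (Z (Z x)).
  by rewrite -rinnerDr Z_eq.
rewrite -[2%:R](rmorph_nat (real_complex R)) rinnerZr QE -rinner_adjoint // -(Z_sym x (Z x)).
rewrite -!rinnerE !rinnerS (rinnerC (Z x) x); lra.
Qed.

(** * Closed spans, projections and reflections *)

Lemma closureP (R : realType) (H : hilbertType R) (A : set H) (x : H) :
  closure A x <-> forall e : R, 0 < e -> exists2 y, A y & rnorm (x - y) < e.
Proof.
split=> [h e e0|h B /nbhs_ballP [e /= e0 eB]].
  have e0' : 0 < e%:C :> R[i] by rewrite ltcR.
  have [y [Ay]] := h _ (nbhsx_ballx x _ e0').
  by rewrite -ball_normE /= rnormE ltcR; exists y.
have er : e = (complex.Re e)%:C by rewrite RRe_real // ger0_real // ltW.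
have [|y Ay xy] := h (complex.Re e); first by rewrite er ltcR in e0.
by exists y; split=> //; apply: eB; rewrite -ball_normE /= rnormE er ltcR.
Qed.

Section ClosedSpan.
Variables (R : realType) (H : hilbertType R).
Implicit Types (S M : set H) (x y : H).

Lemma subset_closed_span S x : S x -> closed_span S x.
Proof.
move=> Sx; apply: subset_closure; exists 1%N, (fun=> 1), (fun=> x); split=> //.
by rewrite big_ord1 scale1r.
Qed.

Lemma linear_span0 S : linear_span S 0.
Proof. by exists 0%N, (fun=> 0), (fun=> 0); split=> [[]|]; rewrite ?big_ord0. Qed.

Lemma linear_spanD S x y : linear_span S x -> linear_span S y -> linear_span S (x + y).
Proof.
move=> [n [c [v [hv ->]]]] [m [d [w [hw ->]]]].
exists (n + m)%N, (fun i => match fintype.split i with inl j => c j | inr j => d j end),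
  (fun i => match fintype.split i with inl j => v j | inr j => w j end); split.
  by move=> i; case: (fintype.split i).
rewrite big_split_ord /=; congr (_ + _); apply: eq_bigr => i _.
  by rewrite (fintype.unsplitK (inl _ i)).
by rewrite (fintype.unsplitK (inr _ i)).
Qed.

Lemma linear_spanZ S (a : R[i]) x : linear_span S x -> linear_span S (a *: x).
Proof.
move=> [n [c [v [hv ->]]]]; exists n, (fun i => a * c i), v; split=> //.
by rewrite scaler_sumr; apply: eq_bigr => i _; rewrite scalerA.
Qed.

Lemma closed_span_subspace S : subspace_closed (closed_span S).
Proof.
split=> [|x y /closureP hx /closureP hy|a x /closureP hx|u l hu ul].
- by apply: subset_closure; exact: linear_span0.
- apply/closureP => e e0; have e2 : 0 < e / 2 by rewrite divr_gt0.
  have [x' Sx' hx'] := hx _ e2; have [y' Sy' hy'] := hy _ e2.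
  exists (x' + y'); first exact: linear_spanD.
  by rewrite opprD addrACA (le_lt_trans (rnormD _ _)) // [ltRHS]splitr ltrD.
- apply/closureP => e e0; have a0 : 0 <= complex.Re `|a| by rewrite -ler0c RRe_real ?normr_real.
  have a1 : 0 < complex.Re `|a| + 1 by rewrite ltr_wpDl.
  have [x' Sx' hx'] := hx _ (divr_gt0 e0 a1).
  exists (a *: x'); first exact: linear_spanZ.
  rewrite -scalerBr rnormZc; move: hx'; rewrite ltr_pdivlMr // mulrC.
  by apply: le_lt_trans; rewrite ler_wpM2r ?rnorm_ge0 // lerDl.
- apply/closureP => e e0; have e2 : 0 < e / 2 by rewrite divr_gt0.
  have [N /(_ N (leqnn _)) hN] := ul _ e2.
  have /closureP/(_ _ e2) [y Sy hy] := hu N.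
  exists y => //; rewrite -(subrKA (u N)) (le_lt_trans (rnormD _ _)) //.
  by rewrite [ltRHS]splitr ltrD // rnormB.
Qed.

Lemma closed_span_min S M :
  subspace_closed M -> (forall x, S x -> M x) -> forall x, closed_span S x -> M x.
Proof.
move=> hM SM x /closureP hx.
have span y : linear_span S y -> M y.
  move=> [n [c [v [hv ->]]]]; apply: (@big_ind _ M).
  - exact: subspace_closed0.
  - by move=> *; exact: subspace_closedD.
  - by move=> i _; apply: subspace_closedZ => //; apply: SM.
have ex n : exists y, M y /\ rnorm (x - y) < n.+1%:R^-1.
  by have [|y /span My xy] := hx n.+1%:R^-1; [rewrite invr_gt0 | exists y].
have [u hu] := choice ex.
apply: (subspace_closed_lim hM (u := u)) => [n|e /invS_small [N hN]]; first by case: (hu n).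
by exists N => n Nn; rewrite rnormB; apply: lt_trans (hN n Nn); case: (hu n).
Qed.

End ClosedSpan.

Lemma equalizer_subspace (R : realType) (H K : hilbertType R) (A B : {linear H -> K}) (C : R) :
  (forall x, rnorm (A x) <= C * rnorm x) -> (forall x, rnorm (B x) <= C * rnorm x) ->
  subspace_closed [set x | A x = B x].
Proof.
move=> hA hB; split=> /= [|x y hx hy|a x hx|u l hu ul]; first by rewrite !linear0.
- by rewrite !linearD hx hy.
- by rewrite !linearZ hx.
- apply: (tends_unique (tends_lipschitz hA ul)).
  have -> : A \o u = B \o u by apply/funext => n /=.
  exact: tends_lipschitz hB ul.
Qed.

(** Orthogonality is taken for the complex [inner]: real orthogonality to an arbitrary set is not
    preserved by complex scalars. *)
Lemma orthogonal_subspace (R : realType) (H : hilbertType R) (S : set H) :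
  subspace_closed [set x | forall s, S s -> inner x s = 0].
Proof.
split=> /= [s _|x y hx hy s Ss|a x hx s Ss|u l hu ul s Ss].
- by rewrite -(scale0r (0 : H)) innerZl mul0r.
- by rewrite innerDl hx // hy // addr0.
- by rewrite innerZl hx // mulr0.
- have lim0 y : (forall n, rinner (u n) y = 0) -> rinner l y = 0.
    move=> h; have cl : (fun n => rinner (u n) y) @ \oo --> rinner l y by exact: cvg_rinner.
    apply: cvg_seq_unique cl; under eq_fun do rewrite h; exact: cvg_cst.
  rewrite innerE !lim0 // => n; have := hu n s Ss; rewrite innerE => /eqP;
    by rewrite eq_complex /= => /andP[/eqP h /eqP h'].
Qed.

Section Projection.
Variables (R : realType) (H : hilbertType R) (M : set H).
Hypothesis hM : subspace_closed M.

Lemma rinnerZcr (a : R[i]) (x y : H) : rinner x (a *: y) = rinner (a^* *: x) y.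
Proof. by rewrite /rinner innerZl innerZr. Qed.

Lemma projection_exists : exists P : {linear H -> H},
  (forall x, M (P x)) /\ (forall x m, M m -> rinner m (x - P x) = 0).
Proof.
have ex x : exists z, M z /\ forall m, M m -> rinner m (x - z) = 0.
  have [||y|z Mz hz] := @riesz R H M (fun m => rinner m x) (rnorm x) hM.
  - by move=> *; rewrite rinnerDl.
  - by move=> *; rewrite rinnerZl.
  - by rewrite mulrC rinner_le.
  by exists z; split=> // m Mm; rewrite rinnerDr rinnerNr hz // subrr.
have [p hp] := choice ex.
have [hMp hpo] : (forall x, M (p x)) /\ (forall x m, M m -> rinner m (x - p x) = 0).
  by split=> x; case: (hp x).
have p_lin : linear p.
  move=> a x y; set d := a *: p x + p y.
  have Md : M d by apply: subspace_closedD => //; apply: subspace_closedZ.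
  have Mw : M (p (a *: x + y) - d).
    by rewrite -scaleN1r; apply: subspace_closedD => //; apply: subspace_closedZ.
  apply/eqP; rewrite -subr_eq0; apply/eqP/rinner_eq0.
  set w := _ - _ in Mw *.
  have h1 := hpo (a *: x + y) w Mw.
  have h2 : rinner w (a *: x + y - d) = 0.
    rewrite /d opprD addrACA -scalerBr rinnerDr hpo // rinnerZcr hpo ?addr0 //.
    exact: subspace_closedZ.
  (* The linearity defect [w] lies in [M] and is a difference of two vectors orthogonal to [M], so
     it is orthogonal to itself. *)
  have {2}-> : w = (a *: x + y - d) - (a *: x + y - p (a *: x + y)).
    by rewrite /w [in RHS]opprB [RHS]addrC subrKA.
  by rewrite rinnerDr rinnerNr h1 h2 subrr.
have [P hP] := linear_of p_lin; exists P.
by split=> x; rewrite hP; [exact: hMp | exact: hpo].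
Qed.

Lemma projection_unique (P : {linear H -> H}) x z :
  (forall x, M (P x)) /\ (forall x m, M m -> rinner m (x - P x) = 0) ->
  M z -> (forall m, M m -> rinner m (x - z) = 0) -> P x = z.
Proof.
move=> [MP oP] Mz oz; apply/eqP; rewrite -subr_eq0; apply/eqP/rinner_eq0.
have Mw : M (P x - z).
  by rewrite -scaleN1r; apply: subspace_closedD => //; apply: subspace_closedZ.
have {2}-> : P x - z = (x - z) - (x - P x) by rewrite opprB [RHS]addrC subrKA.
by rewrite rinnerDr rinnerNr oP // oz // subrr.
Qed.

End Projection.

Lemma inner_hsum (R : realType) (A B : hilbertType R) (x y : hsum A B) :
  inner x y = inner (hfst x) (hfst y) + inner (hsnd x) (hsnd y).
Proof. by rewrite !innerE !rinner_hsum. Qed.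

Section IsometricGraph.
Variables (R : realType) (E F : hilbertType R) (S : set (hsum E F)).
Hypothesis S_isometric : forall s t, S s -> S t ->
  inner (hfst s) (hfst t) = inner (hsnd s) (hsnd t).

(** With [J (u, v) = (u, - v)], the isometry condition on a pair [s], [t] says that [s] is
    orthogonal to [J t]. Orthogonality passes to closed spans, one argument at a time. *)
Lemma span_isometric s t : closed_span S s -> closed_span S t ->
  inner (hfst s) (hfst t) = inner (hsnd s) (hsnd t).
Proof.
pose J (x : hsum E F) : hsum E F := hpair (hfst x) (- hsnd x).
have inJ x y : inner x (J y) = inner (hfst x) (hfst y) - inner (hsnd x) (hsnd y).
  by rewrite inner_hsum /= -scaleN1r innerZr rmorphN1 mulN1r.
have JS x y : inner x (J y) = (inner y (J x))^*.
  by rewrite !inJ rmorphB /= -!innerC.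
have h1 x y : closed_span S x -> S y -> inner x (J y) = 0.
  move=> Sx Sy.
  apply: (closed_span_min (orthogonal_subspace (J @` S)) _ Sx) => [z Sz _ [w Sw <-]|].
    by rewrite inJ S_isometric // subrr.
  by exists y.
move=> Ss St; apply/eqP; rewrite -subr_eq0 -inJ; apply/eqP.
apply: (closed_span_min (orthogonal_subspace (J @` closed_span S)) _ Ss) => [z Sz _ [w Sw <-]|].
  by rewrite JS h1 // rmorph0.
by exists t.
Qed.

(* Since [(g, 0) = ((g, h) + (g, - h)) / 2] and [(g, - h)] is orthogonal to the graph. *)
Lemma graph_projection (P : {linear hsum E F -> hsum E F}) g :
  (forall x, closed_span S (P x)) /\
    (forall x m, closed_span S m -> rinner m (x - P x) = 0) ->
  closed_span S g -> P (hpair (hfst g) 0) = (2^-1)%:C *: g.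
Proof.
move=> hP Sg; have hM := closed_span_subspace S.
apply: (projection_unique hM hP) => [|m Sm]; first exact: (subspace_closedZ hM).
have := congr1 (@complex.Re R) (span_isometric Sm Sg); rewrite -!/(rinner _ _) => h.
by rewrite rinnerDr rinnerNr rinnerZr !rinner_hsum /= rinner0r h; field.
Qed.

End IsometricGraph.

(* [U] is the reflection in the closed span of the pairs [(a h, b h)]. *)
Lemma reflection_exists (R : realType) (H E : hilbertType R) (a b : {linear H -> E}) :
  (forall h, rnorm (a h) = rnorm (b h)) ->
  exists U : {linear hsum E E -> hsum E E},
    [/\ isometric U, forall x, U (U x) = x & forall h, U (hpair (a h) 0) = hpair 0 (b h)].
Proof.
move=> hab.
have rab h k : rinner (a h) (a k) = rinner (b h) (b k).
  have := hab (h + k); move/(congr1 (fun t => t ^+ 2)); rewrite -!rinnerE !linearD /=.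
  rewrite !rinnerS !rinnerE !hab (rinnerC (a k)) (rinnerC (b k)); lra.
pose S := range (fun h => hpair (a h) (b h)).
have S_iso s t : S s -> S t -> inner (hfst s) (hfst t) = inner (hsnd s) (hsnd t).
  by move=> [h _ <-] [k _ <-] /=; rewrite !innerE -!linearZ !rab.
have hM := closed_span_subspace S.
have [P hP] := projection_exists hM; have [MP oP] := hP.
have PP x : P (P x) = P x.
  by apply: (projection_unique hM hP) => // m _; rewrite subrr rinner0r.
exists ((2%:R \*: P) \- idfun); split=> [|x|h] /=.
- apply: isometric_rinner => x /=.
  have h1 := oP x _ (MP x); rewrite -[2%:R](rmorph_nat (real_complex R)).
  by move: h1; rewrite !rinnerS (rinnerC x (P x)) => h1; lra.
- rewrite linearB linearZ /= PP.
  have -> : 2%:R *: P x - P x = P x by rewrite scaler_nat mulr2n addrK.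
  by rewrite opprB addrC subrK.
(* Twice [(a h, b h) / 2] minus [(a h, 0)] is [(0, b h)]. *)
- have -> : P (hpair (a h) 0) = (2^-1)%:C *: hpair (a h) (b h).
    rewrite -(graph_projection S_iso hP) //.
    by apply: subset_closed_span; exists h.
  rewrite scalerA -[2%:R](rmorph_nat (real_complex R)) -rmorphM divff ?pnatr_eq0 // scale1r.
  by apply: hsum_ext; rewrite linearB /= ?subrr ?subr0.
Qed.

(** * And\^o's theorem *)

Section AndoShift.
Variables (R : realType) (H F : hilbertType R) (T1 T2 : {linear H -> H}).
Variables (U U' P P' : {linear F -> F}) (B C : {linear H -> F}).
Hypothesis hT : commuting_contractive_pair T1 T2.
Hypothesis U_iso : isometric U.
Hypothesis U'_iso : isometric U'.
Hypothesis UK : forall x, U (U' x) = x.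
Hypothesis U'K : forall x, U' (U x) = x.
Hypothesis P'E : forall x, P' x = x - P x.
Hypothesis PP : forall x, P (P x) = P x.
Hypothesis P_orth : forall x y, rinner (P x) (y - P y) = 0.
Hypothesis PB : forall h, P (B h) = B h.
Hypothesis PC : forall h, P (C h) = 0.
Hypothesis B_defect : forall h, rinner (B h) (B h) = rinner h h - rinner (T1 h) (T1 h).
Hypothesis C_defect : forall h, rinner (C h) (C h) = rinner h h - rinner (T2 h) (T2 h).
Hypothesis U_exchange : forall h, U (B (T2 h) + C h) = B h + C (T1 h).

Notation L := (hsum H (ell2 F)).

Let pythagoras x : rinner x x = rinner (P x) (P x) + rinner (P' x) (P' x).
Proof.
have := P_orth x x; rewrite -P'E => h.
have {1 2}-> : x = P x + P' x by rewrite P'E addrC subrK.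
exact: rinner_orthoD.
Qed.

Let P_contr : contractive P.
Proof.
apply/contractiveE => x; rewrite -ler_sqr ?nnegrE ?rnorm_ge0 // -!rinnerE.
by rewrite (pythagoras x) lerDl rinner_ge0.
Qed.

Let P'_contr : contractive P'.
Proof.
apply/contractiveE => x; rewrite -ler_sqr ?nnegrE ?rnorm_ge0 // -!rinnerE.
by rewrite (pythagoras x) lerDr rinner_ge0.
Qed.

Let U_contr := isometric_contractive U_iso.
Let U'_contr := isometric_contractive U'_iso.

(** Shifting the [P] part frees the [P] component of coordinate 0, where [B h] fits because it lies
    in the range of [P]. The norm therefore grows by exactly the defect of [T1]. [merge2] does the
    same with [P'] and [C h]. *)
Let merge1 (h : H) (f : ell2 F) : ell2 F := ell2_cons (B h) (ell2_map P f) + ell2_map P' f.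

Let merge2 (h : H) (f : ell2 F) : ell2 F := ell2_map P f + ell2_cons (C h) (ell2_map P' f).

(* On [F]-valued sequences the pair is [U (P' + S P)] and [(P + S P') U'] with [S] the
   unilateral shift, whose product in either order is [S]. *)
Let V1 (z : L) : L := hpair (T1 (hfst z)) (ell2_map U (merge1 (hfst z) (hsnd z))).
Let V2 (z : L) : L := hpair (T2 (hfst z)) (merge2 (hfst z) (ell2_map U' (hsnd z))).

Let merge1_0 h f : merge1 h f 0%N = B h + P' (f 0%N).
Proof. by rewrite ell2D ell2_cons0 ell2_mapE. Qed.

Let merge1_S h f n : merge1 h f n.+1 = P (f n) + P' (f n.+1).
Proof. by rewrite ell2D ell2_consS !ell2_mapE. Qed.

Let merge2_0 h f : merge2 h f 0%N = P (f 0%N) + C h.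
Proof. by rewrite ell2D ell2_cons0 ell2_mapE. Qed.

Let merge2_S h f n : merge2 h f n.+1 = P (f n.+1) + P' (f n).
Proof. by rewrite ell2D ell2_consS !ell2_mapE. Qed.

Let merge1_linear a h k f g :
  merge1 (a *: h + k) (a *: f + g) = a *: merge1 h f + merge1 k g.
Proof.
by apply: ell2_ext => -[|n]; rewrite [RHS]ell2D ell2Z ?merge1_0 ?merge1_S
  !ell2D !ell2Z !linearP scalerDr addrACA.
Qed.

Let merge2_linear a h k f g :
  merge2 (a *: h + k) (a *: f + g) = a *: merge2 h f + merge2 k g.
Proof.
by apply: ell2_ext => -[|n]; rewrite [RHS]ell2D ell2Z ?merge2_0 ?merge2_S
  !ell2D !ell2Z !linearP scalerDr addrACA.
Qed.

Let map_linear (A : {linear F -> F}) a f g : contractive A ->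
  ell2_map A (a *: f + g) = a *: ell2_map A f + ell2_map A g.
Proof.
move=> hA; apply: ell2_ext => n; rewrite ell2_mapE // !ell2D !ell2Z !ell2_mapE //.
exact: linearP.
Qed.

Let V1_linear : linear V1.
Proof.
move=> a z w; apply: hsum_ext; rewrite [RHS]linearP; first exact: (linearP T1).
by rewrite -[LHS]/(ell2_map U (merge1 _ _)) !linearP merge1_linear map_linear.
Qed.

Let V2_linear : linear V2.
Proof.
move=> a z w; apply: hsum_ext; rewrite [RHS]linearP; first exact: (linearP T2).
by rewrite -[LHS]/(merge2 _ (ell2_map U' _)) !linearP map_linear // merge2_linear.
Qed.

Let map_pythagoras f : rinner f f =
  rinner (ell2_map P f) (ell2_map P f) + rinner (ell2_map P' f) (ell2_map P' f).
Proof.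
have h : rinner (ell2_map P f) (ell2_map P' f) = 0.
  by apply: ell2_orthogonal => n; rewrite !ell2_mapE // P'E P_orth.
have {1 2}-> : f = ell2_map P f + ell2_map P' f.
  by apply: ell2_ext => n; rewrite ell2D !ell2_mapE // P'E addrC subrK.
exact: rinner_orthoD.
Qed.

Let merge1_norm h f : rinner (merge1 h f) (merge1 h f) = rinner (B h) (B h) + rinner f f.
Proof.
have o : rinner (ell2_cons (B h) (ell2_map P f)) (ell2_map P' f) = 0.
  apply: ell2_orthogonal => -[|n]; rewrite ?ell2_cons0 ?ell2_consS !ell2_mapE //.
    by rewrite -PB P'E P_orth.
  by rewrite P'E P_orth.
rewrite /merge1 rinner_orthoD // rinner_ell2_cons.
by rewrite -addrA -map_pythagoras.
Qed.

Let merge2_norm h f : rinner (merge2 h f) (merge2 h f) = rinner (C h) (C h) + rinner f f.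
Proof.
have o : rinner (ell2_map P f) (ell2_cons (C h) (ell2_map P' f)) = 0.
  apply: ell2_orthogonal => -[|n]; rewrite ?ell2_cons0 ?ell2_consS !ell2_mapE //.
    by have := P_orth (f 0%N) (C h); rewrite PC subr0.
  by rewrite P'E P_orth.
rewrite /merge2 rinner_orthoD // rinner_ell2_cons.
by rewrite addrCA -map_pythagoras.
Qed.

(** The embedding is [h -> (h, 0)]. The first coordinate of [V1 z] is [T1] of that of [z], so
    [adjoint V1] maps [(h, 0)] to [(adjoint T1 h, 0)]; likewise for [V2]. *)
Lemma ando_shift : exists (PPi : {linear H -> L}) (VV1 VV2 : {linear L -> L}),
  ando_lift T1 T2 PPi VV1 VV2.
Proof.
have Pi_linear : linear (fun h : H => hpair h (0 : ell2 F)).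
  by move=> a h k; apply: hsum_ext; rewrite linearP //= scaler0 addr0.
have [PPi hPi] := linear_of Pi_linear.
have [VV1 hV1] := linear_of V1_linear; have [VV2 hV2] := linear_of V2_linear.
have iso1 : isometric VV1.
  apply: isometric_rinner => z; rewrite hV1 !rinner_hsum /= rinner_ell2_map //
    merge1_norm B_defect; ring.
have iso2 : isometric VV2.
  apply: isometric_rinner => z; rewrite hV2 !rinner_hsum /= merge2_norm rinner_ell2_map //
    C_defect; ring.
exists PPi, VV1, VV2; split=> //.
- apply: isometric_rinner => h.
  by rewrite hPi rinner_hsum /= rinner0l addr0.
- move=> z; rewrite /comp !(hV1, hV2); apply: hsum_ext.
    exact: (pair_commute hT (hfst z)).
  rewrite -[LHS]/(ell2_map U (merge1 (T2 (hfst z)) (merge2 (hfst z) (ell2_map U' (hsnd z))))).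
  rewrite -[RHS]/(merge2 (T1 (hfst z)) (ell2_map U' (ell2_map U (merge1 (hfst z) (hsnd z))))).
  move: (hfst z) (hsnd z) => h f.
  have -> : ell2_map U' (ell2_map U (merge1 h f)) = merge1 h f.
    by apply: ell2_ext => n; rewrite !ell2_mapE.
  have PP' x : P (P' x) = 0 by rewrite P'E linearB PP subrr.
  have P'P x : P' (P x) = 0 by rewrite P'E PP subrr.
  have P'P' x : P' (P' x) = P' x by rewrite [LHS]P'E PP' subr0.
  have P'B k : P' (B k) = 0 by rewrite P'E PB subrr.
  have P'C k : P' (C k) = C k by rewrite P'E PC subr0.
  have PP'D x : P x + P' x = x by rewrite P'E addrC subrK.
  apply: ell2_ext => -[|n].
    (* At coordinate 0 the sequence [f] drops out of both products: they reduce to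
       [U (B (T2 h) + C h)] and [B h + C (T1 h)], equal by the exchange property. *)
    rewrite ell2_mapE // merge1_0 !merge2_0 merge1_0 !ell2_mapE //.
    by rewrite (linearD P') P'P P'C add0r U_exchange (linearD P) PB PP' addr0.
  (* At coordinate [n + 1] both products give [f n]: each of the components [P] and [P'] is shifted
     exactly once. *)
  rewrite ell2_mapE // merge1_S !merge2_S merge1_S.
  have -> : P (merge2 h (ell2_map U' f) n) = P (U' (f n)).
    by case: n => [|n]; rewrite ?merge2_0 ?merge2_S !ell2_mapE // linearD PP ?PC ?PP' addr0.
  have -> : P' (merge1 h f n) = P' (f n).
    by case: n => [|n]; rewrite ?merge1_0 ?merge1_S linearD ?P'B ?P'P P'P' add0r.
  rewrite !ell2_mapE // (linearD P') P'P P'P' add0r PP'D UK.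
  by rewrite (linearD P) PP PP' addr0 PP'D.
- move=> h; rewrite /comp !hPi; apply: adjoint_eq; first exact: isometric_contractive.
  move=> z; rewrite hV1 !rinner_hsum /= !rinner0r !addr0 rinner_adjoint //.
  exact: pair_contractive1 hT.
- move=> h; rewrite /comp !hPi; apply: adjoint_eq; first exact: isometric_contractive.
  move=> z; rewrite hV2 !rinner_hsum /= !rinner0r !addr0 rinner_adjoint //.
  exact: pair_contractive2 hT.
Qed.

End AndoShift.

Lemma hpair_linear (R : realType) (V : lmodType R[i]) (A B : hilbertType R)
  (f : {linear V -> A}) (g : {linear V -> B}) : linear (fun x => hpair (f x) (g x)).
Proof. by move=> a x y; apply: hsum_ext; [exact: (linearP f) | exact: (linearP g)]. Qed.

(** [F] consists of four copies of [H]. [B] and [C] place [D1 h] and [D2 h] in the first and second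
    copy and [P] projects on the first, so that [B (T2 h) + C h = (a h, 0)] and
    [B h + C (T1 h) = (b h, 0)]. *)
Lemma ando_lift_exists (R : realType) (H : hilbertType R) (T1 T2 : {linear H -> H}) :
  commuting_contractive_pair T1 T2 ->
  exists (L : hilbertType R) (PPi : {linear H -> L}) (V1 V2 : {linear L -> L}),
    ando_lift T1 T2 PPi V1 V2.
Proof.
move=> hT.
have [D1 hD1] := defect_operator (pair_contractive1 hT).
have [D2 hD2] := defect_operator (pair_contractive2 hT).
have [a ha] := linear_of (hpair_linear (D1 \o T2) D2).
have [b hb] := linear_of (hpair_linear D1 (D2 \o T1)).
have [h|U [U_iso UU Uab]] := reflection_exists (a := a) (b := b).
  apply/eqP; rewrite -(eqrXn2 (n := 2)) ?rnorm_ge0 // -!rinnerE ha hb !rinner_hsum /=.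
  rewrite !rinnerE !hD1 !hD2; have -> : T1 (T2 h) = T2 (T1 h) by exact: (pair_commute hT h).
  by apply/eqP; ring.
pose E := hsum H H; pose F := hsum E E.
(* The reflection puts [b h] in the second copy of [E]; the swap brings it back to the first. Both
   maps are involutions, so [U \o swap] inverts [swap \o U]. *)
have [swap hswap] := linear_of (hpair_linear (@hsnd R E E) (@hfst R E E)).
have swap_iso : isometric swap.
  by apply: isometric_rinner => x; rewrite hswap !rinner_hsum addrC.
have swapK x : swap (swap x) = x by rewrite !hswap; apply: hsum_ext.
pose first : {linear F -> H} := @hfst R H H \o @hfst R E E.
have [P1 hP1] := linear_of (hpair_linear first (\0 : {linear F -> H})).
have [P hP] := linear_of (hpair_linear P1 (\0 : {linear F -> E})).
have [B1 hB1] := linear_of (hpair_linear D1 (\0 : {linear H -> H})).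
have [B hB] := linear_of (hpair_linear B1 (\0 : {linear H -> E})).
have [C1 hC1] := linear_of (hpair_linear (\0 : {linear H -> H}) D2).
have [C hC] := linear_of (hpair_linear C1 (\0 : {linear H -> E})).
exists (hsum H (ell2 F)).
apply: (@ando_shift R H F T1 T2 (swap \o U) (U \o swap) P (idfun \- P) B C) => //=.
- by move=> x; rewrite /= swap_iso U_iso.
- by move=> x; rewrite /= U_iso swap_iso.
- by move=> x; rewrite UU swapK.
- by move=> x; rewrite swapK UU.
- by move=> x; rewrite !hP !hP1.
- move=> x y; rewrite !hP !hP1 !rinner_hsum /= !rinner0l !addr0.
  by rewrite subrr rinner0r.
- by move=> h; rewrite !hP !hP1 !hB !hB1.
- by move=> h; rewrite !hP !hP1 !hC !hC1; apply: hsum_ext => //; apply: hsum_ext.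
- by move=> h; rewrite hB hB1 !rinner_hsum /= !rinner0l !addr0 !rinnerE hD1.
- by move=> h; rewrite hC hC1 !rinner_hsum /= !rinner0l add0r !addr0 !rinnerE hD2.
move=> h; have -> : B (T2 h) + C h = hpair (a h) 0.
  rewrite hB hB1 hC hC1 ha; apply: hsum_ext; rewrite linearD /= ?addr0 //.
  by apply: hsum_ext; rewrite linearD /= ?addr0 ?add0r.
rewrite Uab hswap hB hB1 hC hC1 hb; apply: hsum_ext; rewrite [RHS]linearD /= ?addr0 //.
by apply: hsum_ext; rewrite [RHS]linearD /= ?addr0 ?add0r.
Qed.

(** * Compressions and pseudo-commuting lifts *)

Section LiftGenerators.
Variables (R : realType) (H K : hilbertType R) (Pi : {linear H -> K}) (W : {linear K -> K}).

Definition lift_generators : set K := \bigcup_n (iter n W @` range Pi).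

Lemma lift_generatorsP x : lift_generators x <-> exists n h, x = iter n W (Pi h).
Proof.
split=> [[n _ [_ [h _ <-] <-]]|[n [h ->]]]; first by exists n, h.
by exists n => //; exists (Pi h) => //; exists h.
Qed.

Lemma iter_lift_linear n : linear (iter n W \o Pi).
Proof.
move=> a x y /=; elim: n => [|n IH] /=; first exact: linearP.
by rewrite IH linearP.
Qed.

Lemma iter_liftZ n (a : R[i]) h : iter n W (Pi (a *: h)) = a *: iter n W (Pi h).
Proof.
have [g hg] := linear_of (iter_lift_linear n).
by rewrite -[LHS]hg linearZ /= hg.
Qed.

Hypothesis minimal : closed_span lift_generators = [set: K].

(** Real orthogonality suffices here because the generators are stable under multiplication by ['i],
    which can be moved onto [h]. *)
Lemma lift_orthogonal_eq0 (d : K) : (forall n h, rinner (iter n W (Pi h)) d = 0) -> d = 0.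
Proof.
move=> hd; have hM := orthogonal_subspace [set d].
have : closed_span lift_generators d by rewrite minimal.
move=> /(closed_span_min hM)/(_ d erefl) h; apply: rinner_eq0; rewrite /rinner h //.
move=> _ /lift_generatorsP [n [k ->]] s ->; rewrite innerE hd.
by rewrite -[rinner _ ('i *: d)]opprK -rinnerZi -iter_liftZ hd oppr0.
Qed.

Lemma lift_maps_eq (L : hilbertType R) (A B : {linear K -> L}) :
  contractive A -> contractive B ->
  (forall n h, A (iter n W (Pi h)) = B (iter n W (Pi h))) -> A =1 B.
Proof.
move=> hA hB AB x.
have hM : subspace_closed [set x | A x = B x].
  by apply: (@equalizer_subspace _ _ _ _ _ 1) => y; rewrite mul1r; move: y; apply/contractiveE.
have : closed_span lift_generators x by rewrite minimal.
by move=> /(closed_span_min hM); apply=> _ /lift_generatorsP [n [h ->]]; exact: AB.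
Qed.

End LiftGenerators.

Section AdjointAlgebra.
Variable R : realType.

Lemma adjoint_comp (H K L : hilbertType R) (A : {linear K -> L}) (B : {linear H -> K}) y :
  contractive A -> contractive B -> adjoint (A \o B) y = adjoint B (adjoint A y).
Proof.
move=> hA hB; apply: adjoint_eq => [x|x /=]; first exact: le_trans (hA _) (hB _).
by rewrite !rinner_adjoint.
Qed.

Lemma adjoint_isometricK (H K : hilbertType R) (A : {linear H -> K}) :
  isometric A -> cancel A (adjoint A).
Proof.
move=> hA x; apply: adjoint_eq => [|y]; first exact: isometric_contractive.
exact: rinner_isometric.
Qed.

End AdjointAlgebra.

(** * Compressions of And\^o lifts are pseudo-commuting *)

Section Forward.
Variables (R : realType) (H K L : hilbertType R) (T1 T2 : {linear H -> H}).
Variables (Pi : {linear H -> K}) (V : {linear K -> K}).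
Variables (PPi : {linear H -> L}) (VV1 VV2 : {linear L -> L}) (tau : {linear K -> L}).
Variables (W1 W2 W : {linear K -> K}).

Lemma compression_pseudo_commuting :
  commuting_contractive_pair T1 T2 -> minimal_isometric_lift (T1 \o T2) Pi V ->
  ando_lift T1 T2 PPi VV1 VV2 -> compression_along Pi V PPi VV1 VV2 tau W1 W2 W ->
  pseudo_commuting_contractive_lift T1 T2 Pi W1 W2 W.
Proof.
move=> [T12 c1 c2] [Pi_iso V_iso V_lift V_min] [_ i1 i2 VV12 l1 l2].
move=> [tau_iso _ tauPi tauV W1E W2E WE].
have ct := isometric_contractive tau_iso.
have cV := isometric_contractive V_iso.
have cv1 := isometric_contractive i1; have cv2 := isometric_contractive i2.
pose VV : {linear L -> L} := VV1 \o VV2.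
have VV_iso : isometric VV by move=> x /=; rewrite i1 i2.
have cVV := isometric_contractive VV_iso.
have T12E x : T1 (T2 x) = T2 (T1 x) by exact: T12.
have tauK := adjoint_isometricK tau_iso.
have tauVE x : tau (V x) = VV (tau x) by exact: tauV.
have tauPiE h : tau (Pi h) = PPi h by exact: tauPi.
have WVE x : W x = V x by rewrite WE /= -[RHS]tauK tauVE.
have WV : (W : K -> K) = V by apply/funext.
have adjT h : adjoint (T1 \o T2) h = adjoint T1 (adjoint T2 h).
  apply: adjoint_eq => [x|x]; first exact: le_trans (c1 _) (c2 _).
  by rewrite /= T12E !rinner_adjoint.
have l1E h : adjoint VV1 (PPi h) = PPi (adjoint T1 h) by exact: l1.
have l2E h : adjoint VV2 (PPi h) = PPi (adjoint T2 h) by exact: l2.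
have V_liftE h : adjoint V (Pi h) = Pi (adjoint (T1 \o T2) h) by exact: V_lift.
(* [K_00] reduces [VV1 VV2]. *)
have adjVV x : adjoint VV (tau x) = tau (adjoint V x).
  have [A hA] := linear_of (adjoint_linear cVV); have [B hB] := linear_of (adjoint_linear cV).
  rewrite -hA -hB; apply: (lift_maps_eq V_min (A := A \o tau) (B := tau \o B)) => {x} [x|x|n h] /=.
  - by rewrite hA (le_trans (adjoint_contractive cVV _)).
  - by rewrite tau_iso hB adjoint_contractive.
  (* For [n = 0] both sides are given by the lifting relations; for positive [n] one factor cancels,
     as [V] and [VV] are isometries. *)
  - rewrite hA hB; case: n => [|n] /=.
      by rewrite tauPiE V_liftE tauPiE [adjoint VV _]adjoint_comp // adjoint_comp // l1E l2E.
    by rewrite tauVE !adjoint_isometricK.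
(* The adjoint form of [adjVV]. It lets [VV] pass through [adjoint tau], so commutation of [VV1] and
   [VV2] with [VV] descends to the compressions. *)
have adjtau y : adjoint tau (VV y) = V (adjoint tau y).
  apply: adjoint_eq => // x; rewrite rinnerC rinner_adjoint // adjVV rinnerC.
  by rewrite rinner_adjoint // rinnerC -rinner_adjoint // rinnerC.
have VVC x : VV1 (VV2 x) = VV2 (VV1 x) by exact: VV12.
have VV1C x : VV1 (VV x) = VV (VV1 x) by rewrite /= VVC.
have VV2C x : VV2 (VV x) = VV (VV2 x) by rewrite /= [RHS]VVC.
have W1Ex x : W1 x = adjoint tau (VV1 (tau x)) by exact: W1E.
have W2Ex x : W2 x = adjoint tau (VV2 (tau x)) by exact: W2E.
have cW1 : contractive W1.
  by move=> x; rewrite W1Ex (le_trans (adjoint_contractive ct _)) // i1 tau_iso.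
have cW2 : contractive W2.
  by move=> x; rewrite W2Ex (le_trans (adjoint_contractive ct _)) // i2 tau_iso.
have cW : contractive W by move=> x; rewrite WVE; exact: cV.
have rinner_tau x y : rinner (adjoint tau x) y = rinner x (tau y).
  by rewrite rinnerC -rinner_adjoint // rinnerC.
split=> //.
- by move=> x; rewrite WVE V_iso.
- by move=> x; rewrite /comp !WVE !W1Ex tauVE VV1C adjtau.
- by move=> x; rewrite /comp !WVE !W2Ex tauVE VV2C adjtau.
(* Paired with [W2 y], the vector [V x] becomes [VV2 (VV1 (tau x))] in [L], and the isometry [VV2]
   cancels. *)
- move=> x; rewrite /comp; apply/esym/adjoint_eq => // y.
  rewrite W1Ex W2Ex WVE rinner_tau tauVE [VV _]VVC rinner_isometric //.
  by rewrite rinner_adjoint.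
- move=> h; rewrite /comp; apply: adjoint_eq => // x.
  by rewrite W1Ex rinner_tau tauPiE rinner_adjoint // l1E -tauPiE rinner_isometric.
- move=> h; rewrite /comp; apply: adjoint_eq => // x.
  by rewrite W2Ex rinner_tau tauPiE rinner_adjoint // l2E -tauPiE rinner_isometric.
- move=> h; rewrite /comp; apply: adjoint_eq => // x.
  by rewrite WVE rinner_adjoint // V_liftE adjT.
- by rewrite WV.
Qed.

End Forward.

(** * A pseudo-commuting lift is determined by its product part *)

Section Uniqueness.
Variables (R : realType) (H K : hilbertType R) (T1 T2 : {linear H -> H}).
Variables (Pi : {linear H -> K}) (W : {linear K -> K}).

(** The mirror image of the factorization, namely that [W2] is [adjoint W1] after [W]. It combines
    the factorization with the commutation of [W2] and [W], and shows that [W1] determines [W2]. *)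
Lemma pseudo_commuting_adjoint (W1 W2 : {linear K -> K}) :
  pseudo_commuting_contractive_lift T1 T2 Pi W1 W2 W ->
  forall x y, rinner (W1 x) (W y) = rinner x (W2 y).
Proof.
move=> [_ c1 c2 iW _ W2C fac _ _ _ _] x y.
rewrite fac rinnerC -rinner_adjoint //; have -> : W2 (W y) = W (W2 y) by exact: W2C.
by rewrite rinner_isometric // rinnerC.
Qed.

Lemma pseudo_commuting_entry (W1 W2 X1 X2 : {linear K -> K}) :
  pseudo_commuting_contractive_lift T1 T2 Pi W1 W2 W ->
  pseudo_commuting_contractive_lift T1 T2 Pi X1 X2 W ->
  forall m n h k, rinner (W1 (iter m W (Pi h))) (iter n W (Pi k)) =
                  rinner (X1 (iter m W (Pi h))) (iter n W (Pi k)).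
Proof.
move=> hW hX.
have aW := pseudo_commuting_adjoint hW; have aX := pseudo_commuting_adjoint hX.
case: hW => _ c1 c2 iW W1C _ _ l1 l2 _ _; case: hX => _ d1 d2 _ X1C _ _ m1 m2 _ _.
have l1E h : adjoint W1 (Pi h) = adjoint X1 (Pi h) by rewrite [LHS]l1 [RHS]m1.
have l2E h : adjoint W2 (Pi h) = adjoint X2 (Pi h) by rewrite [LHS]l2 [RHS]m2.
have W1CE x : W1 (W x) = W (W1 x) by exact: W1C.
have X1CE x : X1 (W x) = W (X1 x) by exact: X1C.
(* If both exponents are positive, a common [W] cancels. If [n = 0], the lifting relation of [W1]
   applies; if only [m = 0], the mirror relation passes to [W2], whose lifting relation
   concludes. *)
elim=> [|m IH] [|n] h k /=; last by rewrite W1CE X1CE !rinner_isometric.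
- by rewrite (rinner_adjoint c1) (rinner_adjoint d1) l1E.
- by rewrite aW aX 2!(rinnerC (Pi h)) (rinner_adjoint c2) (rinner_adjoint d2) l2E.
- by rewrite (rinner_adjoint c1) (rinner_adjoint d1) l1E.
Qed.

Lemma pseudo_commuting_unique (W1 W2 X1 X2 : {linear K -> K}) :
  pseudo_commuting_contractive_lift T1 T2 Pi W1 W2 W ->
  pseudo_commuting_contractive_lift T1 T2 Pi X1 X2 W -> W1 =1 X1 /\ W2 =1 X2.
Proof.
move=> hW hX; have min := pcc_minimal hW.
have E1 : W1 =1 X1.
  apply: (lift_maps_eq min (pcc_contractive1 hW) (pcc_contractive1 hX)) => m h.
  apply/eqP; rewrite -subr_eq0; apply/eqP; apply: (lift_orthogonal_eq0 min) => n k.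
  by rewrite rinnerDr rinnerNr !(rinnerC (iter n W _)) (pseudo_commuting_entry hW hX) subrr.
split=> // y; apply: rinner_ext => x.
by rewrite -(pseudo_commuting_adjoint hW) -(pseudo_commuting_adjoint hX) E1.
Qed.

End Uniqueness.

Lemma preimage_subspace (R : realType) (H K : hilbertType R) (A : {linear H -> K}) (M : set K) :
  contractive A -> subspace_closed M -> subspace_closed [set x | M (A x)].
Proof.
move=> hA [M0 MD MZ Ml]; split=> /= [|x y Mx My|a x Mx|u l Mu ul].
- by rewrite linear0.
- by rewrite linearD; apply: MD.
- by rewrite linearZ; apply: MZ.
- apply: (Ml (A \o u)) => //; apply: (tends_lipschitz (C := 1)) ul => x.
  by rewrite mul1r; move: x; apply/contractiveE.
Qed.

Lemma range_isometric_subspace (R : realType) (H K : hilbertType R) (A : {linear H -> K}) :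
  isometric A -> subspace_closed (range A).
Proof.
move=> hA; have nA x : rnorm (A x) = rnorm x by move: x; apply/isometricE.
split=> [|_ _ [x _ <-] [y _ <-]|a _ [x _ <-]|u l hu ul].
- by exists 0; rewrite ?linear0.
- by exists (x + y); rewrite ?linearD.
- by exists (a *: x); rewrite ?linearZ.
have ex n : exists x, A x = u n by have [x _ <-] := hu n; exists x.
have [v hv] := choice ex.
have fv : fundamental v.
  move=> e e0; have e2 : 0 < e / 2 by rewrite divr_gt0.
  have [N hN] := ul _ e2; exists N => m n /hN hm /hN hn.
  rewrite -nA linearB !hv -(subrKA l) (le_lt_trans (rnormD _ _)) // (rnormB l).
  by rewrite [ltRHS]splitr ltrD.
have [x hx] := fundamental_tends fv; exists x => //.
apply: (tends_unique _ ul); have -> : u = A \o v by apply/funext => n /=.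
by apply: (tends_lipschitz (C := 1)) hx => y; rewrite nA mul1r.
Qed.

(** * Embedding a minimal lift into another isometric lift of the same operator *)

Section MinimalLiftEmbedding.
Variables (R : realType) (H K L : hilbertType R) (S : H -> H).
Variables (Pi : {linear H -> K}) (W : {linear K -> K}).
Variables (PPi : {linear H -> L}) (VV : {linear L -> L}).
Hypothesis Pi_iso : isometric Pi.
Hypothesis W_iso : isometric W.
Hypothesis W_lift : forall h, adjoint W (Pi h) = Pi (S h).
Hypothesis W_min : closed_span (lift_generators Pi W) = [set: K].
Hypothesis PPi_iso : isometric PPi.
Hypothesis VV_iso : isometric VV.
Hypothesis VV_lift : forall h, adjoint VV (PPi h) = PPi (S h).

(** Cancel common powers, then move the remaining ones across, where the adjoint acts on the
    embedded [H] through [S]. The outcome depends only on [S] and [H], hence is the same in [K] and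
    in [L]. *)
Let gram m n h k : rinner (iter m W (Pi h)) (iter n W (Pi k)) =
                   rinner (iter m VV (PPi h)) (iter n VV (PPi k)).
Proof.
have cW := isometric_contractive W_iso; have cV := isometric_contractive VV_iso.
have left p h' k' : rinner (iter p W (Pi h')) (Pi k') = rinner (iter p VV (PPi h')) (PPi k').
  elim: p k' => [|p IH] k' /=; first by rewrite !rinner_isometric.
  by rewrite !rinner_adjoint // W_lift VV_lift IH.
elim: m n => [|m IH] [|n]; rewrite ?left //; last by rewrite /= !rinner_isometric.
by rewrite rinnerC left rinnerC.
Qed.

Let gens : set (hsum K L) :=
  [set x | exists n h, x = hpair (iter n W (Pi h)) (iter n VV (PPi h))].

Let gens_isometric s t : gens s -> gens t ->
  inner (hfst s) (hfst t) = inner (hsnd s) (hsnd t).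
Proof.
move=> [m [h ->]] [n [k ->]] /=; rewrite !innerE gram; congr (_ +i* _).
by rewrite -!iter_liftZ gram.
Qed.

Let gensP n h : closed_span gens (hpair (iter n W (Pi h)) (iter n VV (PPi h))).
Proof. by apply: subset_closed_span; exists n, h. Qed.

(* [tau] is the isometry whose graph is the closed span of the pairs
   [(W^n Pi h, VV^n PPi h)]. *)
Lemma minimal_lift_embedding : exists tau : {linear K -> L},
  [/\ isometric tau, range tau = closed_span (lift_generators PPi VV),
      forall h, tau (Pi h) = PPi h & forall x, tau (W x) = VV (tau x)].
Proof.
have hM := closed_span_subspace gens.
have [P hP] := projection_exists hM; have [MP oP] := hP.
have P_le x : rnorm (P x) <= rnorm x.
  rewrite -ler_sqr ?nnegrE ?rnorm_ge0 // -!rinnerE -[in leRHS](subrK (P x) x).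
  rewrite addrC rinner_orthoD; first by rewrite lerDl rinner_ge0.
  exact: oP.
have [inl hinl] := linear_of (hpair_linear (idfun : {linear K -> K}) (\0 : {linear K -> L})).
(* The factor 2 undoes the one half of [graph_projection], making [G x] the point of the closed
   graph over [x]. *)
pose G : {linear K -> hsum K L} := 2%:R \*: (P \o inl).
have GE g : closed_span gens g -> G (hfst g) = g.
  move=> Gg; rewrite /G /= hinl (graph_projection gens_isometric hP Gg) scalerA.
  by rewrite -[2%:R](rmorph_nat (real_complex R)) -rmorphM divff ?pnatr_eq0 // scale1r.
have G_le x : rnorm (G x) <= 2 * rnorm x.
  rewrite /G /= -[2%:R](rmorph_nat (real_complex R)) rnormZ ger0_norm // ler_wpM2l //.
  apply: le_trans (P_le _) _; rewrite -ler_sqr ?nnegrE ?rnorm_ge0 // -!rinnerE hinl.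
  by rewrite rinner_hsum /= rinner0l addr0.
have GM x : closed_span gens (G x) by apply: (subspace_closedZ hM); exact: MP.
have fst_le (x : hsum K L) : rnorm (hfst x) <= rnorm x.
  by rewrite -ler_sqr ?nnegrE ?rnorm_ge0 // -!rinnerE rinner_hsum lerDl rinner_ge0.
have snd_le (x : hsum K L) : rnorm (hsnd x) <= rnorm x.
  by rewrite -ler_sqr ?nnegrE ?rnorm_ge0 // -!rinnerE rinner_hsum lerDr rinner_ge0.
have Ggen n h : G (iter n W (Pi h)) = hpair (iter n W (Pi h)) (iter n VV (PPi h)).
  exact: (GE _ (@gensP n h)).
(* Known on generators, this extends to all of [K] by minimality: the closed graph has a point over
   every vector. *)
have G1 x : hfst (G x) = x.
  have hE : subspace_closed [set x | (@hfst R K L \o G) x = (idfun : {linear K -> K}) x].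
    apply: (@equalizer_subspace _ _ _ _ _ 2) => y.
      exact: (le_trans (fst_le (G y)) (G_le y)).
    by have := rnorm_ge0 y; rewrite /=; lra.
  have : closed_span (lift_generators Pi W) x by rewrite W_min.
  move=> /(closed_span_min hE); apply=> _ /lift_generatorsP [n [h ->]].
  exact: (congr1 (@hfst R K L) (Ggen n h)).
pose tau : {linear K -> L} := @hsnd R K L \o G.
have tauE n h : tau (iter n W (Pi h)) = iter n VV (PPi h).
  exact: (congr1 (@hsnd R K L) (Ggen n h)).
have tau_iso : isometric tau.
  apply: isometric_rinner => x.
  by rewrite /rinner -(span_isometric gens_isometric (GM x) (GM x)) G1.
exists tau; split=> //.
- apply/seteqP; split=> [_ [x _ <-]|y].
    have hS : subspace_closed
        [set g : hsum K L | closed_span (lift_generators PPi VV) (hsnd g)].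
      apply: preimage_subspace (closed_span_subspace _).
      by apply/contractiveE.
    apply: (closed_span_min hS _ (GM x)) => _ [n [h ->]].
    by apply: subset_closed_span; apply/lift_generatorsP; exists n, h.
  apply: closed_span_min; first exact: range_isometric_subspace.
  by move=> _ /lift_generatorsP [n [h ->]]; exists (iter n W (Pi h)).
- exact: (tauE 0%N).
- apply: (lift_maps_eq W_min (A := tau \o W) (B := VV \o tau)) => [x|x|n h] /=.
  + by rewrite -[X in `|X|]/(tau (W x)) tau_iso W_iso.
  + by rewrite VV_iso -[X in `|X|]/(tau x) tau_iso.
  + by have := tauE n.+1 h; have := tauE n h; rewrite /tau /= => -> ->.
Qed.

End MinimalLiftEmbedding.

Lemma iter_comp_commute (T : Type) (f g : T -> T) (n : nat) :
  (forall x, f (g x) = g (f x)) -> iter n (f \o g) =1 iter n f \o iter n g.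
Proof.
move=> fg x; have gf m y : g (iter m f y) = iter m f (g y).
  by elim: m => [|m IH] //=; rewrite -fg IH.
by elim: n => [|n IH] //=; rewrite IH /= gf.
Qed.

Lemma ando_coreE (R : realType) (H L : hilbertType R) (PPi : {linear H -> L})
    (V1 V2 : {linear L -> L}) : V1 \o V2 =1 V2 \o V1 ->
  ando_core PPi V1 V2 = closed_span (lift_generators PPi (V1 \o V2)).
Proof.
move=> h; rewrite /ando_core /lift_generators; congr closed_span.
apply: eq_bigcupr => n _; congr (_ @` _); apply/funext => x.
by rewrite iter_comp_commute.
Qed.

Unset Implicit Arguments.

Theorem theorem6p1p4 (R : realType) (H K : hilbertType R)
    (T1 T2 : {linear H -> H}) (Pi : {linear H -> K})
    (W1 W2 W : {linear K -> K})
    (hT : commuting_contractive_pair T1 T2)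
    (hPi : isometric Pi)
    (hW1 : continuous W1) (hW2 : continuous W2) (hW : continuous W) :
  is_ando_compression T1 T2 Pi W1 W2 W <->
  pseudo_commuting_contractive_lift T1 T2 Pi W1 W2 W.
Proof.
split=> [[V [mil [L [PPi [VV1 [VV2 [tau [al ca]]]]]]]]|hW12].
  exact: compression_pseudo_commuting hT mil al ca.
have [_ _ _ W_iso _ _ _ _ _ W_lift W_min] := hW12.
have [T12 c1 c2] := hT.
(* The adjoint of [T1 \o T2] composes the two adjoints in the opposite order; commutation of [T1]
   and [T2] reconciles it with the order in the definition. *)
have W_liftE h : adjoint W (Pi h) = Pi (adjoint (T1 \o T2) h).
  rewrite [LHS]W_lift -[LHS]/(Pi (adjoint T1 (adjoint T2 h))); congr (Pi _).
  apply: esym; apply: adjoint_eq => [x|x].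
    exact: le_trans (c1 _) (c2 _).
  have T12E : T1 (T2 x) = T2 (T1 x) by exact: T12.
  by rewrite /= T12E !rinner_adjoint.
have mil : minimal_isometric_lift (T1 \o T2) Pi W by split.
exists W; split=> //.
have [L [PPi [VV1 [VV2 al]]]] := ando_lift_exists hT.
have [PPi_iso i1 i2 VVC l1 l2] := al.
have VV_iso : isometric (VV1 \o VV2) by move=> x /=; rewrite i1 i2.
have VV_lift h : adjoint (VV1 \o VV2) (PPi h) = PPi (adjoint (T1 \o T2) h).
  rewrite !adjoint_comp //; try exact: isometric_contractive.
  by rewrite [adjoint VV1 _]l1 [LHS]l2.
have [tau [tau_iso tau_range tauPi tauW]] :=
  minimal_lift_embedding hPi W_iso W_liftE W_min PPi_iso VV_iso VV_lift.
have ct := isometric_contractive tau_iso.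
have [t ht] := linear_of (adjoint_linear ct).
have tau_comp : compression_along Pi W PPi VV1 VV2 tau (t \o VV1 \o tau) (t \o VV2 \o tau) W.
  split=> //.
  - by rewrite tau_range ando_coreE.
  - by move=> x /=; rewrite ht.
  - by move=> x /=; rewrite ht.
  - by move=> x; rewrite -[LHS](adjoint_isometricK tau_iso) tauW.
(* The compression of the And\^o lift just built is itself pseudo-commuting over the same [Pi] and
   [W], so it coincides with the given pair. *)
have [E1 E2] := pseudo_commuting_unique hW12 (compression_pseudo_commuting hT mil al tau_comp).
exists L, PPi, VV1, VV2, tau; split=> //.
case: tau_comp => *; split=> //.
- by move=> x; rewrite E1 /= ht.
- by move=> x; rewrite E2 /= ht.
Qed.
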